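(* Let $(A,s_A)$ and $(B,s_B)$ be probability MV-algebras, and let $(T,s_T)$ be the product space of $(A,s_A)$ and $(B,s_B)$, with the bilinear map $\beta:A\times B\to T$, $\beta(a,b)=f_a\otimes f_b$ (all defined in the context). For any probability MV-algebra $(C,s_C)$ and any bounded bilinear function $\gamma:A\times B\to C$ there exists a unique bounded linear function $\omega:T\to C^{dc}$ such that $\omega(\beta(a,b))=\gamma(a,b)$ for any $a\in A$, $b\in B$, where $\gamma(a,b)\in C$ is identified with its image in $C^{dc}$; i.e., with $C^{dc}$ identified with $L_1(\mu_C)_u$, $\omega(f_a\otimes f_b)=f_{\gamma(a,b)}$ for any $a\in A$, $b\in B$.
   Context: An MV-algebra is a structure $(A,\oplus,{}^*,0)$ such that $(A,\oplus,0)$ is a commutative monoid, $a^{**}=a$, $a\oplus 0^*=0^*$ and $(a^*\oplus b)^*\oplus b=(b^*\oplus a)^*\oplus a$. Put $1=0^*$, $a\odot b=(a^*\oplus b^* )^*$, $d(a,b)=(a\odot b^* )\oplus(b\odot a^* )$; $a\le b$ iff $a\odot b^*=0$ (a lattice order). The partial sum $a+b$ is defined iff $a\le b^*$, and then $a+b=a\oplus b$. A map $\omega$ between MV-algebras is linear if $\omega(a+b)=\omega(a)+\omega(b)$ (the right side being defined) whenever $a\le b^*$; bilinear means linear in each argument. A state is a linear map $s:A\to[0,1]$ with $s(1)=1$; faithful if $s(a)=0$ implies $a=0$; $\sigma$-continuous if $\lim_n s(a_n)=s(a)$ for every increasing sequence with $\bigvee_n a_n=a$. A probability MV-algebra is a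 pair $(A,s)$ with $A$ a $\sigma$-complete MV-algebra (every countable subset has a supremum) and $s$ a faithful $\sigma$-continuous state. Such $A$ is semisimple (embeds in the MV-algebra $C(X)$ of continuous $[0,1]$-valued functions on a compact Hausdorff $X$). For $t\in[0,1]$ and a natural number $K\ge1$, $K_\oplus t=\min(Kt,1)$. For MV-algebras with states, a linear function $\omega:(A,s_A)\to(C,s_C)$ is bounded if there is a natural $K\ge1$ with $s_C(\omega(a))\le K_\oplus s_A(a)$ for all $a$. A bilinear $\gamma:A\times B\to C$ is bounded if there is a natural $K\ge1$ with $s_C(\gamma(a,b))\le K_\oplus(s_A(a)s_B(b))$ for all $a,b$. For a probability MV-algebra $(A,s_A)$, $A\subseteq C(X)$, let $A^d=\{\frac{a_1}{n}+\dots+\frac{a_n}{n}\mid a_i\in A,\ n\ge1\}$ be its divisible hull, $s_A^d$ the extension of $s_A$ to a state on $A^d$, and $(A^{dc},s_A^{dc})$ the state-completion of $(A^d,s_A^d)$: the set of classes of Cauchy sequences for $\rho(x,y)=s_A^d(d(x,y))$ (sequences identified if $\rho(x_n,y_n)\to0$), with componentwise operations and $s_A^{dc}([\{x_n\}])=\lim_n s_A^d(x_n)$. For a measure space, $L_1(\mu)_u=\{f\in L_1(\mu)\mid\mathbf0\le f\le\mathbf1\}$ with $f\oplus g=\min(f+g,\mathbf1)$, $f^*=\mathbf1-f$. It is a known fact that there are a probability space $(X_A,\Omega_A,\mu_A)$, with $X_A$ extremally disconnected compact Hausdorff and $\Omega_A$ its Borel $\sigma$-algebra, and an isomorphism $A^{dc}\simeq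 L_1(\mu_A)_u$ (of MV-algebras, preserving multiplication by scalars in $[0,1]$) under which $s_A^{dc}$ becomes $f\mapsto\int f\,d\mu_A$. Fix these for $A$, $B$ and $C$. For $a\in A$ let $f_a\in L_1(\mu_A)_u$ be the image of $a$ under $A\hookrightarrow A^d\hookrightarrow A^{dc}\simeq L_1(\mu_A)_u$; define $f_b\in L_1(\mu_B)_u$ for $b\in B$ and $f_c\in L_1(\mu_C)_u$ for $c\in C$ likewise. Let $(X_A\times X_B,\Lambda,\lambda)$ be the product measure space, $\lambda$ being the c.l.d. (complete locally determined) product measure in Fremlin's sense (for these finite measures, the completion of the usual product measure). For $f\in L_1(\mu_A)$, $g\in L_1(\mu_B)$ let $f\otimes g\in L_1(\lambda)$ be the class of $(x,y)\mapsto f(x)g(y)$. The product space of $(A,s_A)$ and $(B,s_B)$ is $(T,s_T)$ with $T=L_1(\lambda)_u$, $s_T(f)=\int_{X_A\times X_B}f\,d\lambda$. Boundedness of $\omega:T\to C^{dc}$ is with respect to $s_T$ and $s_C^{dc}$. *)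

(* Defs.v *)
From HB Require Import structures.
From mathcomp Require Import all_boot all_order all_algebra.
From mathcomp Require Import all_classical all_reals all_analysis.
From mathcomp Require Import measurable_realfun.
From mathcomp Require Import ring lra.

Set Implicit Arguments.
Unset Strict Implicit.
Unset Printing Implicit Defensive.

Import Order.TTheory GRing.Theory Num.Theory.
Import numFieldNormedType.Exports.

Local Open Scope classical_set_scope.
Local Open Scope ring_scope.

Declare Scope mv_scope.
Delimit Scope mv_scope with MV.

HB.mixin Record isMV (A : Type) := {
  mv_add : A -> A -> A;
  mv_neg : A -> A;
  mv_zero : A;
  mv_addA : associative mv_add;
  mv_addC : commutative mv_add;
  mv_addx0 : right_id mv_zero mv_add;
  mv_negK : involutive mv_neg;
  mv_addx1 : forall a, mv_add a (mv_neg mv_zero) = mv_neg mv_zero;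
  mv_lukasiewicz : forall a b,
    mv_add (mv_neg (mv_add (mv_neg a) b)) b =
    mv_add (mv_neg (mv_add (mv_neg b) a)) a
}.

#[short(type=mvType)]
HB.structure Definition MV := {A of isMV A}.

Notation "x ⊕ y" := (mv_add x y) (at level 50, left associativity) : mv_scope.
Notation "¬ x" := (mv_neg x) (at level 35, right associativity) : mv_scope.
Local Open Scope mv_scope.

Definition mv_one {A : mvType} : A := ¬ mv_zero.
Definition mv_mul {A : mvType} (a b : A) : A := ¬ (¬ a ⊕ ¬ b).
Notation "x ⊙ y" := (mv_mul x y) (at level 40, left associativity) : mv_scope.
Definition mv_dist {A : mvType} (a b : A) : A := (a ⊙ ¬ b) ⊕ (b ⊙ ¬ a).
Definition mv_le {A : mvType} (a b : A) : Prop := a ⊙ ¬ b = mv_zero.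

Definition mv_is_sup {A : mvType} (S : set A) (a : A) : Prop :=
  (forall b, S b -> mv_le b a) /\
  (forall c, (forall b, S b -> mv_le b c) -> mv_le a c).

Definition mv_sigma_complete (A : mvType) : Prop :=
  forall S : set A, countable S -> exists a, mv_is_sup S a.

Definition mv_hom {A B : mvType} (f : A -> B) : Prop :=
  [/\ f mv_zero = mv_zero,
      forall a, f (¬ a) = ¬ f a &
      forall a b, f (a ⊕ b) = f a ⊕ f b].

(* The condition [mv_le (w a) (¬ w b)] says that the partial sum
   [w a + w b] is defined. *)
Definition mv_linear {A B : mvType} (w : A -> B) : Prop :=
  forall a b, mv_le a (¬ b) ->
    mv_le (w a) (¬ w b) /\ w (a ⊕ b) = w a ⊕ w b.

Definition mv_bilinear {A B C : mvType} (g : A -> B -> C) : Prop :=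
  (forall b, mv_linear (g^~ b)) /\ (forall a, mv_linear (g a)).

(* In the MV-algebra [0,1] the partial sum of s a and s b is their real sum,
   defined iff s a + s b <= 1; here this follows from s (a ⊕ b) <= 1. *)
Definition mv_state {R : realType} {A : mvType} (s : A -> R) : Prop :=
  [/\ forall a, 0 <= s a <= 1,
      forall a b, mv_le a (¬ b) -> s (a ⊕ b) = s a + s b &
      s mv_one = 1].

Record state (R : realType) (A : mvType) := State {
  state_fun :> A -> R;
  stateP : mv_state state_fun
}.

Definition mv_faithful {R : realType} {A : mvType} (s : A -> R) : Prop :=
  forall a, s a = 0 -> a = mv_zero.

Definition mv_sigma_continuous {R : realType} {A : mvType} (s : A -> R) : Prop :=
  forall (u : nat -> A) (a : A), (forall n, mv_le (u n) (u n.+1)) ->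
    mv_is_sup (range u) a -> s (u n) @[n --> \oo] --> s a.

Definition probability_mv {R : realType} {A : mvType} (s : state R A) : Prop :=
  [/\ mv_sigma_complete A, mv_faithful s & mv_sigma_continuous s].

Definition mv_bounded {R : realType} {A C : mvType} (sA : A -> R) (sC : C -> R)
    (w : A -> C) : Prop :=
  exists2 K : nat, (1 <= K)%N &
    forall a, sC (w a) <= Num.min (K%:R * sA a) 1.

Definition mv_bounded2 {R : realType} {A B C : mvType}
    (sA : A -> R) (sB : B -> R) (sC : C -> R) (g : A -> B -> C) : Prop :=
  exists2 K : nat, (1 <= K)%N &
    forall a b, sC (g a b) <= Num.min (K%:R * (sA a * sB b)) 1.

Section mv_theory.
Variable A : mvType.
Implicit Types a b c : A.

Lemma mv_add0x a : mv_zero ⊕ a = a.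
Proof. by rewrite mv_addC mv_addx0. Qed.

Lemma mv_mulC a b : a ⊙ b = b ⊙ a.
Proof. by rewrite /mv_mul mv_addC. Qed.

Lemma mv_mulA a b c : a ⊙ (b ⊙ c) = a ⊙ b ⊙ c.
Proof. by rewrite /mv_mul !mv_negK mv_addA. Qed.

Lemma mv_neg1 : ¬ (mv_one : A) = mv_zero.
Proof. exact: mv_negK. Qed.

Lemma mv_addxN a : a ⊕ ¬ a = mv_one.
Proof.
have := mv_lukasiewicz (¬ mv_zero : A) a.
by rewrite mv_negK mv_add0x mv_addx1 mv_addC.
Qed.

Lemma mv_mulxN a : a ⊙ ¬ a = mv_zero.
Proof. by rewrite /mv_mul mv_addxN mv_neg1. Qed.

Lemma mv_joinC a b : (a ⊙ ¬ b) ⊕ b = (b ⊙ ¬ a) ⊕ a.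
Proof. by rewrite /mv_mul !mv_negK mv_lukasiewicz. Qed.

Lemma mv_le_refl a : mv_le a a.
Proof. exact: mv_mulxN. Qed.

Lemma mv_le_addr a b : mv_le a (a ⊕ b).
Proof.
rewrite /mv_le /mv_mul mv_negK mv_addA.
rewrite (mv_addC (¬ a)) mv_addxN mv_addC mv_addx1; exact: mv_neg1.
Qed.

Lemma mv_le_decomp a b : mv_le a b -> b = a ⊕ (b ⊙ ¬ a).
Proof.
by move=> ab; have := mv_joinC a b; rewrite ab mv_add0x mv_addC => {1}->; rewrite mv_addC.
Qed.

Lemma mv_le_trans b a c : mv_le a b -> mv_le b c -> mv_le a c.
Proof.
move=> /mv_le_decomp -> /mv_le_decomp ->; rewrite -mv_addA; exact: mv_le_addr.
Qed.

Lemma mv_le_add2r c a b : mv_le a b -> mv_le (a ⊕ c) (b ⊕ c).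
Proof.
move=> /mv_le_decomp ->; rewrite -mv_addA (mv_addC (b ⊙ _)) mv_addA.
exact: mv_le_addr.
Qed.

Lemma mv_le_add a b c d : mv_le a b -> mv_le c d -> mv_le (a ⊕ c) (b ⊕ d).
Proof.
move=> ab cd; apply: (@mv_le_trans (b ⊕ c)); first exact: mv_le_add2r.
by rewrite !(mv_addC b); exact: mv_le_add2r.
Qed.

Lemma mv_le_residual a b c : mv_le a (b ⊕ c) -> mv_le (a ⊙ ¬ b) c.
Proof.
by rewrite /mv_le => <-; rewrite -mv_mulA; congr (_ ⊙ _); rewrite /mv_mul !mv_negK.
Qed.

Lemma mv_le_join a b : mv_le a (b ⊕ (a ⊙ ¬ b)).
Proof. rewrite mv_addC mv_joinC mv_addC; exact: mv_le_addr. Qed.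

Lemma mv_distxx a : mv_dist a a = mv_zero.
Proof. by rewrite /mv_dist mv_mulxN mv_addx0. Qed.

Lemma mv_distC a b : mv_dist a b = mv_dist b a.
Proof. by rewrite /mv_dist mv_addC. Qed.

Lemma mv_distN a b : mv_dist (¬ a) (¬ b) = mv_dist a b.
Proof.
by rewrite /mv_dist !mv_negK (mv_mulC _ b) (mv_mulC _ a) mv_addC.
Qed.

Lemma mv_sub_triangle b a c :
  mv_le (a ⊙ ¬ c) ((a ⊙ ¬ b) ⊕ (b ⊙ ¬ c)).
Proof.
apply: mv_le_residual; apply: mv_le_trans (mv_le_join a b) _.
rewrite (mv_addC (a ⊙ ¬ b)) mv_addA.
apply: mv_le_add2r; exact: mv_le_join.
Qed.

Lemma mv_addACA a b c d : (a ⊕ b) ⊕ (c ⊕ d) = (a ⊕ c) ⊕ (b ⊕ d).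
Proof. by rewrite -!mv_addA; congr (_ ⊕ _); rewrite !mv_addA (mv_addC b). Qed.

Lemma mv_dist_triangle b a c :
  mv_le (mv_dist a c) (mv_dist a b ⊕ mv_dist b c).
Proof.
rewrite {2 3}/mv_dist (mv_addACA (a ⊙ _)) (mv_addC (b ⊙ ¬ a)).
by apply: mv_le_add; exact: mv_sub_triangle.
Qed.

Lemma mv_sub_add2r c a b : mv_le ((a ⊕ c) ⊙ ¬ (b ⊕ c)) (a ⊙ ¬ b).
Proof.
apply: mv_le_residual; rewrite -mv_addA (mv_addC c) mv_addA.
apply: mv_le_add2r; exact: mv_le_join.
Qed.

Lemma mv_dist_add2r c a b : mv_le (mv_dist (a ⊕ c) (b ⊕ c)) (mv_dist a b).
Proof. by apply: mv_le_add; exact: mv_sub_add2r. Qed.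

Lemma mv_dist_add a b c d :
  mv_le (mv_dist (a ⊕ c) (b ⊕ d)) (mv_dist a b ⊕ mv_dist c d).
Proof.
apply: mv_le_trans (mv_dist_triangle (b ⊕ c) _ _) _.
apply: mv_le_add; first exact: mv_dist_add2r.
by rewrite !(mv_addC b); exact: mv_dist_add2r.
Qed.

Variables (R : realType) (s : state R A).

Lemma state_ge0 a : 0 <= s a.
Proof. by have [/(_ a)/andP[]] := stateP s. Qed.

Lemma state_le1 a : s a <= 1.
Proof. by have [/(_ a)/andP[]] := stateP s. Qed.

Lemma stateD a b : mv_le a (¬ b) -> s (a ⊕ b) = s a + s b.
Proof. by have [_ + _] := stateP s; apply. Qed.

Lemma state0 : s mv_zero = 0.
Proof.
have : s (mv_zero ⊕ mv_zero) = s mv_zero + s mv_zero.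
  apply: stateD; rewrite /mv_le mv_negK.
  by rewrite /mv_mul mv_addx1 mv_negK.
rewrite mv_addx0; lra.
Qed.

Lemma state_le a b : mv_le a b -> s a <= s b.
Proof.
move=> /mv_le_decomp ->; rewrite stateD ?lerDl ?state_ge0//.
by rewrite /mv_le !mv_negK mv_mulC -mv_mulA (mv_mulC _ a) mv_mulxN
  /mv_mul mv_addx1 mv_negK.
Qed.

Lemma state_add_le a b : s (a ⊕ b) <= s a + s b.
Proof.
have ab : a ⊕ b = a ⊕ ((a ⊕ b) ⊙ ¬ a).
  by rewrite [LHS](mv_le_decomp (mv_le_addr a b)).
have le_b : mv_le ((a ⊕ b) ⊙ ¬ a) b by apply: mv_le_residual; exact: mv_le_refl.
rewrite ab stateD ?lerD2l ?state_le//.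
by rewrite /mv_le !mv_negK mv_mulC -mv_mulA (mv_mulC _ a) mv_mulxN
  /mv_mul mv_addx1 mv_negK.
Qed.

Lemma state_dist_triangle b a c :
  s (mv_dist a c) <= s (mv_dist a b) + s (mv_dist b c).
Proof.
exact: le_trans (state_le (mv_dist_triangle b a c)) (state_add_le _ _).
Qed.

Lemma state_dist_add a b c d :
  s (mv_dist (a ⊕ c) (b ⊕ d)) <= s (mv_dist a b) + s (mv_dist c d).
Proof.
exact: le_trans (state_le (mv_dist_add a b c d)) (state_add_le _ _).
Qed.

End mv_theory.

Section unit_interval.
Variable R : realType.
Implicit Types x y z : R.

Definition uadd x y : R := Num.min (x + y) 1.
Definition uneg x : R := 1 - x.

Ltac min_lra :=
  rewrite /uadd /uneg ?minEle ?maxEle;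
  repeat match goal with |- context [if (?a <= ?b)%O then _ else _] =>
    lazymatch constr:((a, b)) with
    | context [if _ then _ else _] => fail
    | _ => let H := fresh in case: (leP a b) => H; try (exfalso; lra)
    end end;
  lra.

Lemma uadd_itv x y : 0 <= x <= 1 -> 0 <= y <= 1 -> 0 <= uadd x y <= 1.
Proof. by move=> /andP[? ?] /andP[? ?]; apply/andP; split; min_lra. Qed.

Lemma uneg_itv x : 0 <= x <= 1 -> 0 <= uneg x <= 1.
Proof. by move=> /andP[? ?]; apply/andP; split; min_lra. Qed.

Lemma uaddA x y z : 0 <= x -> 0 <= y -> 0 <= z ->
  uadd x (uadd y z) = uadd (uadd x y) z.
Proof. move=> *; min_lra. Qed.

Lemma uaddC x y : uadd x y = uadd y x.
Proof. by rewrite /uadd addrC. Qed.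

Lemma uaddx0 x : x <= 1 -> uadd x 0 = x.
Proof. move=> *; min_lra. Qed.

Lemma unegK x : uneg (uneg x) = x.
Proof. rewrite /uneg; lra. Qed.

Lemma uaddx1 x : 0 <= x -> uadd x (uneg 0) = uneg 0.
Proof. move=> *; min_lra. Qed.

Lemma u_lukasiewicz x y : 0 <= x <= 1 -> 0 <= y <= 1 ->
  uadd (uneg (uadd (uneg x) y)) y = uadd (uneg (uadd (uneg y) x)) x.
Proof. move=> /andP[? ?] /andP[? ?]; min_lra. Qed.

Lemma uaddE x y : x + y <= 1 -> uadd x y = x + y.
Proof. move=> *; min_lra. Qed.

Lemma umul_eq0 x y : uneg (uadd (uneg x) (uneg (uneg y))) = 0 -> x <= y.
Proof. min_lra. Qed.

Lemma u_meet x y : 0 <= x <= 1 -> 0 <= y <= 1 ->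
  uneg (uadd (uneg y) (uneg (uneg (uneg (uadd (uneg (uadd x y)) (uneg (uneg x)))))))
  = uneg (uadd (uneg x) (uneg y)).
Proof. move=> /andP[? ?] /andP[? ?]; min_lra. Qed.

(* For x >= 0, x is the sum of its slices uslice 1 x, uslice 2 x, ..., of which
   at most one is different from 0 and 1. *)
Definition uslice (k : nat) x : R := Num.max 0 (Num.min 1 (x + 1 - k%:R)).

Lemma uslice0 x : 0 <= x -> uslice 0 x = 1.
Proof. by rewrite /uslice => *; min_lra. Qed.

Lemma usliceS0 k : uslice k.+1 0 = 0.
Proof. rewrite /uslice -natr1; have := ler0n R k; min_lra. Qed.

Lemma uslice_itv k x : 0 <= uslice k x <= 1.
Proof. by rewrite /uslice; apply/andP; split; min_lra. Qed.

Lemma uslice_cases k x :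
  (x <= k%:R /\ uslice k.+1 x = 0) \/ (k%:R <= x /\ uslice k x = 1).
Proof.
rewrite /uslice -natr1; have [xk|kx] := leP x k%:R.
  by left; split=> //; min_lra.
by right; split; [exact: ltW|min_lra].
Qed.

Lemma usliceD k x y : 0 <= y <= 1 ->
  uslice k.+1 (y + x) =
  uadd (uslice k.+1 x) (uneg (uadd (uneg (uslice k x)) (uneg y))).
Proof.
move=> /andP[y0 y1]; have [[xk ->]|[kx ->]] := uslice_cases k x.
  have -> : uslice k x = Num.max 0 (x + 1 - k%:R) by rewrite /uslice; min_lra.
  have -> : uslice k.+1 (y + x) = Num.max 0 (y + x - k%:R).
    by rewrite /uslice -natr1; min_lra.
  min_lra.
have -> : uneg (uadd (uneg 1) (uneg y)) = y by min_lra.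
have -> : uslice k.+1 x = Num.min 1 (x - k%:R).
  by rewrite /uslice -natr1; min_lra.
have -> : uslice k.+1 (y + x) = Num.min 1 (y + x - k%:R).
  by rewrite /uslice -natr1; min_lra.
min_lra.
Qed.

Lemma uslice_mul k x y : 0 <= y <= 1 ->
  uneg (uadd (uneg (uslice k.+1 x))
             (uneg (uneg (uadd (uneg (uslice k x)) (uneg y))))) =
  uneg (uadd (uneg (uslice k.+1 x)) (uneg y)).
Proof.
have /andP[] := uslice_itv k x; have /andP[] := uslice_itv k.+1 x.
move: (uslice k.+1 x) (uslice k x) (uslice_cases k x).
move=> u v uv u0 u1 v0 v1 /andP[y0 y1].
by case: uv => [[_ E]|[_ E]]; rewrite E; min_lra.
Qed.

Lemma uslice_sum N x : 0 <= x ->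
  \sum_(0 <= k < N) uslice k.+1 x = Num.min x N%:R.
Proof.
move=> x0; elim: N => [|N IH]; first by rewrite big_nil; min_lra.
rewrite big_nat_recr//= IH /uslice -natr1; min_lra.
Qed.

Lemma uslice_gt k x : x <= k%:R -> uslice k.+1 x = 0.
Proof. rewrite /uslice -natr1 => ?; min_lra. Qed.

End unit_interval.

Section continuous_functions.
Variables (R : realType) (X : topologicalType).

Record CX := MkCX {
  CX_fun :> X -> R;
  CX_continuous : continuous (CX_fun : X -> R^o);
  CX_itv : forall x, 0 <= CX_fun x <= 1
}.

Lemma CX_eq (f g : CX) : (forall x, f x = g x) -> f = g.
Proof.
case: f g => [f cf f01] [g cg g01] /= /funext fg; subst g.
by congr MkCX; exact: Prop_irrelevance.
Qed.

Let ge0 (f : CX) x : 0 <= f x. Proof. by case/andP: (CX_itv f x). Qed.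
Let le1 (f : CX) x : f x <= 1. Proof. by case/andP: (CX_itv f x). Qed.

Lemma CX_add_continuous (f g : CX) :
  continuous ((fun x => Num.min (f x + g x) 1) : X -> R^o).
Proof.
move=> x.
apply: (@continuous_min R X (fun x => f x + g x) (cst 1)).
  by apply: (@continuousD _ R^o); exact: CX_continuous.
exact: cst_continuous.
Qed.

Definition CX_add (f g : CX) : CX :=
  @MkCX _ (@CX_add_continuous f g) (fun x => uadd_itv (CX_itv f x) (CX_itv g x)).

Lemma CX_neg_continuous (f : CX) : continuous ((fun x => 1 - f x) : X -> R^o).
Proof.
move=> x; apply: (@continuousB _ R^o); first exact: cst_continuous.
exact: CX_continuous.
Qed.

Definition CX_neg (f : CX) : CX :=
  @MkCX _ (@CX_neg_continuous f) (fun x => uneg_itv (CX_itv f x)).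

Lemma CX_zero_itv (x : X) : 0 <= (0 : R) <= 1.
Proof. by rewrite lexx ler01. Qed.

Definition CX_zero : CX :=
  @MkCX (fun=> 0) (@cst_continuous X R^o 0) CX_zero_itv.

Let addA : associative CX_add.
Proof. by move=> f g h; apply: CX_eq => x; exact: uaddA. Qed.
Let addC : commutative CX_add.
Proof. by move=> f g; apply: CX_eq => x; exact: uaddC. Qed.
Let addx0 : right_id CX_zero CX_add.
Proof. by move=> f; apply: CX_eq => x; exact: uaddx0. Qed.
Let negK : involutive CX_neg.
Proof. by move=> f; apply: CX_eq => x; exact: unegK. Qed.
Let addx1 f : CX_add f (CX_neg CX_zero) = CX_neg CX_zero.
Proof. by apply: CX_eq => x; exact: uaddx1. Qed.
Let lukasiewicz f g : CX_add (CX_neg (CX_add (CX_neg f) g)) g =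
  CX_add (CX_neg (CX_add (CX_neg g) f)) f.
Proof. by apply: CX_eq => x; apply: u_lukasiewicz; exact: CX_itv. Qed.

HB.instance Definition _ := @isMV.Build CX CX_add CX_neg CX_zero
  addA addC addx0 negK addx1 lukasiewicz.

End continuous_functions.

Record CX_embedding (R : realType) (A : mvType) := CXEmbedding {
  emb_space : topologicalType;
  emb_compact : compact [set: emb_space];
  emb_hausdorff : hausdorff_space emb_space;
  emb :> A -> CX R emb_space;
  emb_hom : mv_hom emb;
  emb_inj : injective emb
}.

Section divisible_hull.
Variables (R : realType) (A : mvType) (E : CX_embedding R A).
Local Notation X := (emb_space E).

Let emb_itv a x : 0 <= E a x <= 1. Proof. exact: CX_itv. Qed.
Let emb_ge0 a x : 0 <= E a x. Proof. by case/andP: (emb_itv a x). Qed.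
Let emb_le1 a x : E a x <= 1. Proof. by case/andP: (emb_itv a x). Qed.

Lemma emb0 x : E mv_zero x = 0.
Proof. by have [-> _ _] := emb_hom E. Qed.
Lemma embN a x : E (¬ a) x = uneg (E a x).
Proof. by have [_ -> _] := emb_hom E. Qed.
Lemma embD a b x : E (a ⊕ b) x = uadd (E a x) (E b x).
Proof. by have [_ _ ->] := emb_hom E. Qed.
Lemma emb1 x : E mv_one x = 1.
Proof. by rewrite embN emb0 /uneg subr0. Qed.
Lemma embM a b x : E (a ⊙ b) x = uneg (uadd (uneg (E a x)) (uneg (E b x))).
Proof. by rewrite embN embD !embN. Qed.
Lemma emb_eq a b : (forall x, E a x = E b x) -> a = b.
Proof. by move=> ab; apply: emb_inj (CX_eq ab). Qed.

(* s = [:: a_1; ...; a_n] *)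
Definition is_divisible_comb (f : X -> R) : Prop :=
  exists2 s : seq A, (0 < size s)%N &
    forall x, f x = \sum_(a <- s) E a x / (size s)%:R.

Record divHull := DivHull {
  hull_fun :> X -> R;
  hullP : is_divisible_comb hull_fun
}.

Lemma hull_eq (f g : divHull) : (forall x, f x = g x) -> f = g.
Proof.
case: f g => [f cf] [g cg] /= /funext fg; subst g.
by congr DivHull; exact: Prop_irrelevance.
Qed.

Lemma sum_emb_ge0 s x : 0 <= \sum_(a <- s) E a x.
Proof. by apply: sumr_ge0 => a _. Qed.

Lemma sum_emb_le s x : \sum_(a <- s) E a x <= (size s)%:R.
Proof.
elim: s => [|a s IH]; first by rewrite big_nil.
by rewrite big_cons /= -nat1r lerD.
Qed.

Lemma hull_itv (f : divHull) x : 0 <= f x <= 1.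
Proof.
have [s s0 ->] := hullP f; rewrite -mulr_suml.
have s0' : 0 < (size s)%:R :> R by rewrite ltr0n.
by rewrite divr_ge0 ?sum_emb_ge0 ?ler0n//= ler_pdivrMr// mul1r sum_emb_le.
Qed.

Let ge0 (f : divHull) x : 0 <= f x. Proof. by case/andP: (hull_itv f x). Qed.
Let le1 (f : divHull) x : f x <= 1. Proof. by case/andP: (hull_itv f x). Qed.

(* The slices of a_1 + ... + a_n lie in A (a good sequence in Mundici's sense):
   A^d is therefore closed under truncated sum, and s_A^d is well defined. *)
Fixpoint slice (s : seq A) (k : nat) : A :=
  match k, s with
  | 0, _ => mv_one
  | k'.+1, [::] => mv_zero
  | k'.+1, a :: s' => slice s' k ⊕ (slice s' k' ⊙ a)
  end.

Lemma sliceE s k x : E (slice s k) x = uslice k (\sum_(a <- s) E a x).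
Proof.
elim: s k => [|a s IH] [|k] /=.
- by rewrite emb1 uslice0 ?sum_emb_ge0.
- by rewrite emb0 big_nil usliceS0.
- by rewrite emb1 uslice0 ?sum_emb_ge0.
- by rewrite big_cons usliceD ?emb_itv// embD embM !IH.
Qed.

Definition copies (n : nat) (s : seq A) : seq A := flatten (nseq n s).

Lemma size_copies n s : size (copies n s) = (n * size s)%N.
Proof. by rewrite size_flatten /shape map_nseq sumn_nseq mulnC. Qed.

Lemma sum_copies n s (F : A -> R) :
  \sum_(a <- copies n s) F a = n%:R * \sum_(a <- s) F a.
Proof.
elim: n => [|n IH]; first by rewrite big_nil mul0r.
by rewrite big_cat/= IH -nat1r mulrDl mul1r.
Qed.

Lemma hull_add_proof (f g : divHull) :
  is_divisible_comb (fun x => Num.min (f x + g x) 1).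
Proof.
have [s s0 fE] := hullP f; have [t t0 gE] := hullP g.
pose u := copies (size t) s ++ copies (size s) t.
pose N := (size s * size t)%N.
have N0 : (0 < N)%N by rewrite muln_gt0 s0.
exists [seq slice u k.+1 | k <- iota 0 N].
  by rewrite size_map size_iota.
move=> x; rewrite size_map size_iota -mulr_suml big_map.
under eq_bigr => k _ do rewrite sliceE.
have -> : iota 0 N = index_iota 0 N by rewrite /index_iota subn0.
rewrite uslice_sum ?sum_emb_ge0// /u big_cat/= !sum_copies.
rewrite fE gE -!mulr_suml.
have s0' : 0 < (size s)%:R :> R by rewrite ltr0n.
have t0' : 0 < (size t)%:R :> R by rewrite ltr0n.
have N0' : 0 < N%:R :> R by rewrite ltr0n.
rewrite [RHS]mulrC -[LHS](mulKf (lt0r_neq0 N0')); congr (_ * _).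
rewrite minr_pMr ?ltW// mulr1; congr (Num.min _ _).
by rewrite /N natrM; field; rewrite !gt_eqF.
Qed.

Lemma hull_neg_proof (f : divHull) : is_divisible_comb (fun x => 1 - f x).
Proof.
have [s s0 fE] := hullP f.
exists [seq ¬ a | a <- s]; first by rewrite size_map.
move=> x; rewrite size_map fE big_map -!mulr_suml.
under [in RHS]eq_bigr do rewrite embN /uneg.
have s0' : 0 < (size s)%:R :> R by rewrite ltr0n.
have -> : \sum_(a <- s) (1 - E a x) = (size s)%:R - \sum_(a <- s) E a x.
  by rewrite sumrB big_const_seq count_predT iter_addr_0.
by rewrite mulrBl divff ?gt_eqF.
Qed.

Lemma hull_in_proof a : is_divisible_comb (E a).
Proof. by exists [:: a] => // x; rewrite big_seq1 divr1. Qed.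

Definition hull_add f g := DivHull (hull_add_proof f g).
Definition hull_neg f := DivHull (hull_neg_proof f).
Definition hull_in a : divHull := DivHull (hull_in_proof a).
Lemma hull_zero_proof : is_divisible_comb (fun=> 0).
Proof. by exists [:: mv_zero] => // x; rewrite big_seq1 divr1 emb0. Qed.
Definition hull_zero := DivHull hull_zero_proof.

Let addA : associative hull_add.
Proof. by move=> f g h; apply: hull_eq => x; exact: uaddA. Qed.
Let addC : commutative hull_add.
Proof. by move=> f g; apply: hull_eq => x; exact: uaddC. Qed.
Let addx0 : right_id hull_zero hull_add.
Proof. by move=> f; apply: hull_eq => x; exact: uaddx0. Qed.
Let negK : involutive hull_neg.
Proof. by move=> f; apply: hull_eq => x; exact: unegK. Qed.
Let addx1 f : hull_add f (hull_neg hull_zero) = hull_neg hull_zero.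
Proof. by apply: hull_eq => x; exact: uaddx1. Qed.
Let lukasiewicz f g : hull_add (hull_neg (hull_add (hull_neg f) g)) g =
  hull_add (hull_neg (hull_add (hull_neg g) f)) f.
Proof. by apply: hull_eq => x; apply: u_lukasiewicz; exact: hull_itv. Qed.

HB.instance Definition _ := @isMV.Build divHull hull_add hull_neg hull_zero
  addA addC addx0 negK addx1 lukasiewicz.

Lemma emb_le a b : mv_le a b <-> forall x, E a x <= E b x.
Proof.
split=> [ab x|ab].
  by apply: umul_eq0; rewrite -[uneg (E b x)]embN -embM ab emb0.
apply: emb_eq => x; rewrite embM embN emb0.
have abx := ab x; rewrite /uneg /uadd minEle; case: leP; lra.
Qed.

Variable sA : state R A.

Lemma state_modular a b : sA (a ⊕ b) + sA (a ⊙ b) = sA a + sA b.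
Proof.
pose c := (a ⊕ b) ⊙ ¬ a.
have addE : a ⊕ b = a ⊕ c by rewrite [LHS](mv_le_decomp (mv_le_addr a b)).
have bE : b = c ⊕ (b ⊙ ¬ c).
  apply: mv_le_decomp; apply: mv_le_residual; exact: mv_le_refl.
have dE : b ⊙ ¬ c = a ⊙ b.
  apply: emb_eq => x.
  by rewrite /c !(embM, embN, embD) u_meet ?emb_itv.
have ac : mv_le a (¬ c).
  rewrite /mv_le mv_negK /c mv_mulC -mv_mulA (mv_mulC _ a) mv_mulxN.
  by rewrite /mv_mul mv_addx1 mv_negK.
have cb : mv_le c (¬ (b ⊙ ¬ c)).
  rewrite /mv_le mv_negK mv_mulC -mv_mulA (mv_mulC _ c) mv_mulxN.
  by rewrite /mv_mul mv_addx1 mv_negK.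
by rewrite addE (stateD sA ac) [in RHS]bE (stateD sA cb) dE addrA.
Qed.

Lemma slice_gt s k : (size s <= k)%N -> slice s k.+1 = mv_zero.
Proof.
move=> sk; apply: emb_eq => x; rewrite sliceE emb0 uslice_gt//.
by rewrite (le_trans (sum_emb_le s x))// ler_nat.
Qed.

Lemma sum_slice s N : (size s <= N)%N ->
  \sum_(0 <= k < N) sA (slice s k.+1) = \sum_(a <- s) sA a.
Proof.
elim: s N => [|a s IH] N /= sN.
  by rewrite big_nil big1// => k _; rewrite state0.
rewrite big_cons -(IH N) 1?ltnW//.
have step k : sA (slice s k.+1 ⊕ (slice s k ⊙ a)) =
    sA (slice s k.+1) + (sA (slice s k ⊙ a) - sA (slice s k.+1 ⊙ a)).
  have := state_modular (slice s k.+1) (slice s k ⊙ a).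
  have -> : slice s k.+1 ⊙ (slice s k ⊙ a) = slice s k.+1 ⊙ a.
    by apply: emb_eq => x; rewrite !embM !sliceE uslice_mul ?emb_itv.
  lra.
under eq_bigr do rewrite step.
rewrite big_split/= [RHS]addrC; congr (_ + _).
under eq_bigr do rewrite -opprB.
rewrite sumrN (telescope_sumr (fun k => sA (slice s k ⊙ a)))// opprB.
case: N sN => // N sN; rewrite slice_gt//.
have -> : slice s 0 = mv_one by case: (s).
have -> : mv_zero ⊙ a = mv_zero.
  by rewrite /mv_mul mv_addC mv_addx1 mv_negK.
by rewrite state0 subr0 /mv_mul mv_negK mv_add0x mv_negK.
Qed.

Lemma sum_state_unique s t :
  (forall x, \sum_(a <- s) E a x = \sum_(a <- t) E a x) ->
  \sum_(a <- s) sA a = \sum_(a <- t) sA a.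
Proof.
move=> st; pose N := maxn (size s) (size t).
rewrite -(@sum_slice s N) ?leq_maxl// -(@sum_slice t N) ?leq_maxr//.
apply: eq_bigr => k _; congr (sA _).
by apply: emb_eq => x; rewrite !sliceE st.
Qed.

(* a_1/n + ... + a_n/n |-> (s_A a_1 + ... + s_A a_n)/n, on a chosen
   decomposition; see hull_stateE for the independence of the choice. *)
Definition hull_state_fun (f : divHull) : R :=
  let s := sval (cid2 (hullP f)) in \sum_(a <- s) sA a / (size s)%:R.

Lemma hull_stateE (f : divHull) s (N : nat) : (0 < N)%N ->
  (forall x, f x = \sum_(a <- s) E a x / N%:R) ->
  hull_state_fun f = \sum_(a <- s) sA a / N%:R.
Proof.
rewrite /hull_state_fun; case: cid2 => t /= t0 ft N0 fs.
have N0' : N%:R != 0 :> R by rewrite pnatr_eq0 -lt0n.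
have t0' : (size t)%:R != 0 :> R by rewrite pnatr_eq0 -lt0n.
have : \sum_(a <- copies N t) sA a = \sum_(a <- copies (size t) s) sA a.
  apply: sum_state_unique => x; rewrite !sum_copies.
  have := fs x; rewrite ft -!mulr_suml.
  by move/(congr1 (fun z => z * N%:R * (size t)%:R)); rewrite mulfVK// mulrAC
     mulfVK// [LHS]mulrC [RHS]mulrC.
rewrite !sum_copies -!mulr_suml => h.
by apply/eqP; rewrite eqr_div//; apply/eqP; rewrite mulrC h mulrC.
Qed.

Lemma hull_state_in a : hull_state_fun (hull_in a) = sA a.
Proof.
rewrite (@hull_stateE _ [:: a] 1)// ?big_seq1 ?divr1// => x.
by rewrite big_seq1 divr1.
Qed.

Lemma hull_stateP : mv_state hull_state_fun.
Proof.
split.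
- move=> f; have [s s0 fE] := hullP f; rewrite (hull_stateE s0 fE).
  have s0' : 0 < (size s)%:R :> R by rewrite ltr0n.
  rewrite -mulr_suml divr_ge0 ?ler0n ?sumr_ge0//=; last first.
    by move=> a _; exact: state_ge0.
  rewrite ler_pdivrMr// mul1r -sum1_size natr_sum.
  by apply: ler_sum => a _; exact: state_le1.
- move=> f g fg; have [s s0 fE] := hullP f; have [t t0 gE] := hullP g.
  have fg1 x : f x + g x <= 1.
    have := congr1 (fun h : divHull => h x) fg => /= /umul_eq0.
    rewrite /uneg; lra.
  pose u := copies (size t) s ++ copies (size s) t.
  pose N := (size s * size t)%N.
  have N0 : (0 < N)%N by rewrite muln_gt0 s0.
  have s0' : (size s)%:R != 0 :> R by rewrite pnatr_eq0 -lt0n.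
  have t0' : (size t)%:R != 0 :> R by rewrite pnatr_eq0 -lt0n.
  rewrite (@hull_stateE _ u N)//; last first.
    move=> x; rewrite [LHS](uaddE (fg1 x)) fE gE -!mulr_suml big_cat/=.
    by rewrite !sum_copies /N natrM; field; rewrite s0' t0'.
  rewrite (hull_stateE s0 fE) (hull_stateE t0 gE) -!mulr_suml big_cat/=.
  by rewrite !sum_copies /N natrM; field; rewrite s0' t0'.
- have -> : (mv_one : divHull) = hull_in mv_one.
    by apply: hull_eq => x /=; rewrite emb1 subr0.
  by rewrite hull_state_in; have [_ _] := stateP sA.
Qed.

Definition hull_state : state R divHull := State hull_stateP.

End divisible_hull.

Section state_completion.
Variables (R : realType) (M : mvType) (s : state R M).

Definition rho (a b : M) : R := s (mv_dist a b).

Definition is_cauchy (x : nat -> M) : Prop :=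
  forall e : R, 0 < e -> exists N : nat,
    forall m n, (N <= m)%N -> (N <= n)%N -> rho (x m) (x n) < e.

Record cauchy_seq := CauchySeq {
  cauchy_fun :> nat -> M;
  cauchyP : is_cauchy cauchy_fun
}.

HB.instance Definition _ := gen_eqMixin cauchy_seq.
HB.instance Definition _ := gen_choiceMixin cauchy_seq.

Definition cauchy_eq (x y : cauchy_seq) : bool :=
  `[< rho (x n) (y n) @[n --> \oo] --> (0 : R) >].

Lemma rho_ge0 a b : 0 <= rho a b.
Proof. exact: state_ge0. Qed.

Lemma rhoxx a : rho a a = 0.
Proof. by rewrite /rho mv_distxx state0. Qed.

Lemma rhoC a b : rho a b = rho b a.
Proof. by rewrite /rho mv_distC. Qed.

Lemma rho_triangle b a c : rho a c <= rho a b + rho b c.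
Proof. exact: state_dist_triangle. Qed.

Lemma rho_add a b c d : rho (a ⊕ c) (b ⊕ d) <= rho a b + rho c d.
Proof. exact: state_dist_add. Qed.

Lemma rho_neg a b : rho (¬ a) (¬ b) = rho a b.
Proof. by rewrite /rho mv_distN. Qed.

Lemma squeeze0 (u v : nat -> R) : (forall n, 0 <= u n <= v n) ->
  v n @[n --> \oo] --> (0 : R) -> u n @[n --> \oo] --> (0 : R).
Proof.
by move=> uv v0; apply: (squeeze_cvgr _ (cvg_cst 0) v0); exact: nearW.
Qed.

Lemma cauchy_eq_refl : reflexive cauchy_eq.
Proof.
move=> x; apply/asboolP; under eq_cvg do rewrite rhoxx.
exact: cvg_cst.
Qed.

Lemma cauchy_eq_sym : symmetric cauchy_eq.
Proof.
by move=> x y; apply/asboolP/asboolP => h; under eq_cvg do rewrite rhoC.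
Qed.

Lemma cauchy_eq_trans : transitive cauchy_eq.
Proof.
move=> y x z /asboolP xy /asboolP yz; apply/asboolP.
apply: (@squeeze0 _ (fun n => rho (x n) (y n) + rho (y n) (z n))).
  by move=> n; rewrite rho_ge0 rho_triangle.
by rewrite -[X in _ --> X](addr0 (0 : R)); exact: cvgD.
Qed.

Canonical cauchy_eq_equiv :=
  EquivRel cauchy_eq cauchy_eq_refl cauchy_eq_sym cauchy_eq_trans.

Lemma cauchy_add_proof (x y : cauchy_seq) : is_cauchy (fun n => x n ⊕ y n).
Proof.
move=> e e0; have e2 : 0 < e / 2 by rewrite divr_gt0.
have [N1 h1] := cauchyP x e2; have [N2 h2] := cauchyP y e2.
exists (maxn N1 N2) => m n; rewrite !geq_max => /andP[m1 m2] /andP[n1 n2].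
apply: le_lt_trans (rho_add _ _ _ _) _.
by rewrite (splitr e) ltrD ?h1 ?h2.
Qed.

Lemma cauchy_neg_proof (x : cauchy_seq) : is_cauchy (fun n => ¬ x n).
Proof.
move=> e /(cauchyP x)[N h]; exists N => m n Nm Nn.
by rewrite rho_neg h.
Qed.

Lemma cauchy_cst_proof (a : M) : is_cauchy (fun=> a).
Proof. by move=> e e0; exists 0%N => m n _ _; rewrite rhoxx. Qed.

Definition cauchy_add x y := CauchySeq (cauchy_add_proof x y).
Definition cauchy_neg x := CauchySeq (cauchy_neg_proof x).
Definition cauchy_cst a := CauchySeq (cauchy_cst_proof a).

Local Open Scope quotient_scope.

Definition completion : Type := {eq_quot cauchy_eq}.
HB.instance Definition _ := Choice.on completion.
HB.instance Definition _ := EqQuotient.on completion.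

Definition cauchy_class (x : cauchy_seq) : completion := \pi_completion x.
Definition completion_in (a : M) : completion := cauchy_class (cauchy_cst a).

Lemma cauchy_classP (x y : cauchy_seq) :
  cauchy_class x = cauchy_class y <-> rho (x n) (y n) @[n --> \oo] --> (0 : R).
Proof.
by split=> [/eqmodP/asboolP|h] //; apply/eqmodP/asboolP.
Qed.

Lemma cauchy_class_repr p : cauchy_class (repr p) = p.
Proof. exact: reprK. Qed.

Definition completion_add (p q : completion) : completion :=
  cauchy_class (cauchy_add (repr p) (repr q)).
Definition completion_neg (p : completion) : completion :=
  cauchy_class (cauchy_neg (repr p)).
Definition completion_zero : completion := completion_in mv_zero.

Lemma completion_addE x y :
  completion_add (cauchy_class x) (cauchy_class y) =
  cauchy_class (cauchy_add x y).
Proof.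
apply/cauchy_classP.
set x' := repr _; set y' := repr _.
apply: (@squeeze0 _ (fun n => rho (x' n) (x n) + rho (y' n) (y n))).
  by move=> n; rewrite rho_ge0 rho_add.
rewrite -[X in _ --> X](addr0 (0 : R)).
by apply: cvgD; apply/cauchy_classP; exact: cauchy_class_repr.
Qed.

Lemma completion_negE x :
  completion_neg (cauchy_class x) = cauchy_class (cauchy_neg x).
Proof.
apply/cauchy_classP => /=; under eq_cvg do rewrite rho_neg.
by apply/cauchy_classP; exact: cauchy_class_repr.
Qed.

Lemma cauchy_class_eq (x y : cauchy_seq) :
  (forall n, x n = y n) -> cauchy_class x = cauchy_class y.
Proof.
move=> xy; apply/cauchy_classP; under eq_cvg do rewrite xy rhoxx.
exact: cvg_cst.
Qed.

Let addA : associative completion_add.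
Proof.
move=> p q r; rewrite -[p]cauchy_class_repr -[q]cauchy_class_repr.
rewrite -[r]cauchy_class_repr !completion_addE.
by apply: cauchy_class_eq => n; exact: mv_addA.
Qed.
Let addC : commutative completion_add.
Proof.
move=> p q; rewrite -[p]cauchy_class_repr -[q]cauchy_class_repr.
by rewrite !completion_addE; apply: cauchy_class_eq => n; exact: mv_addC.
Qed.
Let addx0 : right_id completion_zero completion_add.
Proof.
move=> p; rewrite -[p]cauchy_class_repr completion_addE.
by apply: cauchy_class_eq => n; exact: mv_addx0.
Qed.
Let negK : involutive completion_neg.
Proof.
move=> p; rewrite -[p]cauchy_class_repr !completion_negE.
by apply: cauchy_class_eq => n; exact: mv_negK.
Qed.
Let addx1 p : completion_add p (completion_neg completion_zero) =
  completion_neg completion_zero.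
Proof.
rewrite -[p]cauchy_class_repr completion_negE completion_addE.
by apply: cauchy_class_eq => n; exact: mv_addx1.
Qed.
Let lukasiewicz p q :
  completion_add (completion_neg (completion_add (completion_neg p) q)) q =
  completion_add (completion_neg (completion_add (completion_neg q) p)) p.
Proof.
rewrite -[p]cauchy_class_repr -[q]cauchy_class_repr.
rewrite !(completion_negE, completion_addE).
by apply: cauchy_class_eq => n; exact: mv_lukasiewicz.
Qed.

HB.instance Definition _ := @isMV.Build completion
  completion_add completion_neg completion_zero
  addA addC addx0 negK addx1 lukasiewicz.

Definition completion_state (p : completion) : R :=
  limn (fun n => s (repr p n)).

End state_completion.

Section divisible_completion.
Variables (R : realType) (A : mvType) (E : CX_embedding R A) (sA : state R A).

(* A^dc, A^d being the divisible hull of A in C(X) *)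
Definition dcompl : Type := completion (hull_state E sA).
HB.instance Definition _ := MV.on dcompl.
Definition dcompl_state (p : dcompl) : R := completion_state p.
Definition dcompl_in (a : A) : dcompl :=
  completion_in (hull_state E sA) (hull_in E a).

(* [dcompl_scale t p q] means q = t p: A^d is closed under multiplication by
   the rationals of [0,1], and t [x_n] = [r_n x_n] for any rationals r_n of
   [0,1] with limit t. *)
Definition dcompl_scale (t : R) (p q : dcompl) : Prop :=
  exists (x y : cauchy_seq (hull_state E sA)) (r : nat -> rat),
    [/\ p = cauchy_class x, q = cauchy_class y,
        forall n, 0 <= r n <= 1,
        (ratr (r n) : R) @[n --> \oo] --> t &
        forall n u, y n u = ratr (r n) * x n u].

End divisible_completion.

Section L1_unit_interval.
Context d (T : measurableType d) (R : realType) (mu : probability T R).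

(* L_1(mu)_u; the elements of the library's L_1 are classes modulo mu-a.e.
   equality, coerced to functions through a representative. *)
Record L1u := MkL1u {
  L1u_val :> LspaceType mu (@lexx _ _ (1%E : \bar R));
  L1u_itv : {ae mu, forall x, 0 <= (L1u_val x : R) <= 1}
}.

Lemma L1u_eq (f g : L1u) : {ae mu, forall x, (f x : R) = g x} -> f = g.
Proof.
case: f g => [[f [[finf]]] f01] [[g [[fing]]] g01] /= fg.
have {}fg : f = g.
  rewrite -[f]reprK -[g]reprK; apply/eqmodP/asboolP.
  by move: fg; apply: filterS => x.
subst g; have -> : finf = fing by exact: bool_irrelevance.
by congr MkL1u; exact: Prop_irrelevance.
Qed.

Section L1u_class.
Variables (f : T -> R) (mf : measurable_fun setT f).
Hypothesis f01 : {ae mu, forall x, 0 <= f x <= 1}.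

Let fm : {mfun T >-> measurableTypeR R} :=
  @mfun_Sub _ _ _ (measurableTypeR R) f (mem_set mf).
Let cf : {mfun_ mu, T >-> measurableTypeR R} :=
  \pi_({mfun_ mu, T >-> measurableTypeR R})%qT fm.

Let cf_ae : {ae mu, forall x, (cf x : R) = f x}.
Proof.
have : (\pi_({mfun_ mu, T >-> measurableTypeR R}) (repr cf) = \pi fm)%qT.
  by rewrite reprK.
by move=> /eqmodP/asboolP; apply: filterS => x; apply.
Qed.

Let cf_itv : {ae mu, forall x, 0 <= (cf x : R) <= 1}.
Proof. by apply: filterS2 cf_ae f01 => x ->. Qed.

Let cf_finite : finite_norm mu 1 (cf : T -> R).
Proof.
rewrite /finite_norm Lnorm1.
apply: (@le_lt_trans _ _ (\int[mu]_x (cst 1%E x))%E); last first.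
  rewrite integral_cst// mul1e.
  by apply: le_lt_trans (probability_le1 mu measurableT) _; rewrite ltry.
apply: ae_ge0_le_integral => //.
- apply: measurableT_comp => //; apply: measurableT_comp => //.
  exact: (@measurable_funPT _ _ _ _ (repr cf)).
- apply: filterS cf_itv => x /andP[x0 x1] _ /=.
  by rewrite lee_fin (ger0_norm x0).
Qed.

Definition L1u_class : L1u :=
  @MkL1u (@LebesgueSpace.Pack _ _ _ _ _ _ cf
    (LebesgueSpace.Class (isFinLebesgue.phant_Build _ cf_finite))) cf_itv.

Lemma L1u_classE : {ae mu, forall x, (L1u_class x : R) = f x}.
Proof. exact: cf_ae. Qed.

End L1u_class.

Lemma L1u_measurable (f : L1u) : measurable_fun setT (f : T -> R).
Proof. exact: (@measurable_funPT _ _ _ _ (repr (LebesgueSpace.sort (L1u_val f)))). Qed.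

Lemma L1u_add_measurable (f g : L1u) :
  measurable_fun setT (fun x => Num.min ((f x : R) + g x) 1).
Proof.
apply: measurable_minr => //; apply: measurable_funD; exact: L1u_measurable.
Qed.

Lemma L1u_add_itv (f g : L1u) :
  {ae mu, forall x, 0 <= Num.min ((f x : R) + g x) 1 <= 1}.
Proof. by apply: filterS2 (L1u_itv f) (L1u_itv g) => x; exact: uadd_itv. Qed.

Lemma L1u_neg_measurable (f : L1u) :
  measurable_fun setT (fun x => 1 - (f x : R)).
Proof. by apply: measurable_funB => //; exact: L1u_measurable. Qed.

Lemma L1u_neg_itv (f : L1u) : {ae mu, forall x, 0 <= 1 - (f x : R) <= 1}.
Proof. by apply: filterS (L1u_itv f) => x; exact: uneg_itv. Qed.

Lemma L1u_zero_itv : {ae mu, forall x : T, 0 <= (0 : R) <= 1}.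
Proof. by apply: aeW => x; rewrite lexx ler01. Qed.

Definition L1u_add (f g : L1u) : L1u :=
  L1u_class (@L1u_add_measurable f g) (L1u_add_itv f g).
Definition L1u_neg (f : L1u) : L1u :=
  L1u_class (@L1u_neg_measurable f) (L1u_neg_itv f).
Definition L1u_zero : L1u :=
  L1u_class (@measurable_cst _ _ T R setT 0) L1u_zero_itv.

Lemma L1u_addE f g : {ae mu, forall x, (L1u_add f g x : R) = uadd (f x) (g x)}.
Proof. exact: L1u_classE. Qed.
Lemma L1u_negE f : {ae mu, forall x, (L1u_neg f x : R) = uneg (f x)}.
Proof. exact: L1u_classE. Qed.
Lemma L1u_zeroE : {ae mu, forall x, (L1u_zero x : R) = 0}.
Proof. exact: L1u_classE. Qed.

Let addA : associative L1u_add.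
Proof.
move=> f g h; apply: L1u_eq.
near=> x; have /andP[f0 _] : 0 <= (f x : R) <= 1 by near: x; exact: L1u_itv.
have /andP[g0 _] : 0 <= (g x : R) <= 1 by near: x; exact: L1u_itv.
have /andP[h0 _] : 0 <= (h x : R) <= 1 by near: x; exact: L1u_itv.
have -> : (L1u_add f (L1u_add g h) x : R) = uadd (f x) (L1u_add g h x).
  by near: x; exact: L1u_addE.
have -> : (L1u_add g h x : R) = uadd (g x) (h x) by near: x; exact: L1u_addE.
have -> : (L1u_add (L1u_add f g) h x : R) = uadd (L1u_add f g x) (h x).
  by near: x; exact: L1u_addE.
have -> : (L1u_add f g x : R) = uadd (f x) (g x) by near: x; exact: L1u_addE.
exact: uaddA.
Unshelve. all: by end_near. Qed.

Let addC : commutative L1u_add.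
Proof.
move=> f g; apply: L1u_eq.
by apply: filterS2 (L1u_addE f g) (L1u_addE g f) => x -> ->; exact: uaddC.
Qed.

Let addx0 : right_id L1u_zero L1u_add.
Proof.
move=> f; apply: L1u_eq.
apply: filterS3 (L1u_addE f L1u_zero) L1u_zeroE (L1u_itv f) => x -> ->.
by move=> /andP[_]; exact: uaddx0.
Qed.

Let negK : involutive L1u_neg.
Proof.
move=> f; apply: L1u_eq.
by apply: filterS2 (L1u_negE (L1u_neg f)) (L1u_negE f) => x -> ->; exact: unegK.
Qed.

Let addx1 f : L1u_add f (L1u_neg L1u_zero) = L1u_neg L1u_zero.
Proof.
apply: L1u_eq; near=> x.
have /andP[f0 _] : 0 <= (f x : R) <= 1 by near: x; exact: L1u_itv.
have -> : (L1u_add f (L1u_neg L1u_zero) x : R) = uadd (f x) (L1u_neg L1u_zero x).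
  by near: x; exact: L1u_addE.
have -> : (L1u_neg L1u_zero x : R) = uneg (L1u_zero x).
  by near: x; exact: L1u_negE.
have -> : (L1u_zero x : R) = 0 by near: x; exact: L1u_zeroE.
exact: uaddx1.
Unshelve. all: by end_near. Qed.

Let luk f g : {ae mu, forall x,
  (L1u_add (L1u_neg (L1u_add (L1u_neg f) g)) g x : R) =
  uadd (uneg (uadd (uneg (f x)) (g x))) (g x)}.
Proof.
near=> x.
have -> : (L1u_add (L1u_neg (L1u_add (L1u_neg f) g)) g x : R) =
    uadd (L1u_neg (L1u_add (L1u_neg f) g) x) (g x) by near: x; exact: L1u_addE.
have -> : (L1u_neg (L1u_add (L1u_neg f) g) x : R) =
    uneg (L1u_add (L1u_neg f) g x) by near: x; exact: L1u_negE.
have -> : (L1u_add (L1u_neg f) g x : R) = uadd (L1u_neg f x) (g x).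
  by near: x; exact: L1u_addE.
by have -> : (L1u_neg f x : R) = uneg (f x) by near: x; exact: L1u_negE.
Unshelve. all: by end_near. Qed.

Let lukasiewicz f g : L1u_add (L1u_neg (L1u_add (L1u_neg f) g)) g =
  L1u_add (L1u_neg (L1u_add (L1u_neg g) f)) f.
Proof.
apply: L1u_eq; near=> x.
have -> : (L1u_add (L1u_neg (L1u_add (L1u_neg f) g)) g x : R) =
  uadd (uneg (uadd (uneg (f x)) (g x))) (g x) by near: x; exact: luk.
have -> : (L1u_add (L1u_neg (L1u_add (L1u_neg g) f)) f x : R) =
  uadd (uneg (uadd (uneg (g x)) (f x))) (f x) by near: x; exact: luk.
by apply: u_lukasiewicz; near: x; exact: L1u_itv.
Unshelve. all: by end_near. Qed.

HB.instance Definition _ := @isMV.Build L1u L1u_add L1u_neg L1u_zero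
  addA addC addx0 negK addx1 lukasiewicz.

Definition L1u_int (f : L1u) : R := (\int[mu]_x (f x : R))%R.

End L1_unit_interval.

Section product.
Context d1 d2 (X : measurableType d1) (Y : measurableType d2) (R : realType).
Variables (mu : probability X R) (nu : probability Y R).

Local Notation pm := ((mu \x nu)%E : {measure set (X * Y) -> \bar R}).

(* The c.l.d. product of two probability measures is the completion of their
   product measure: the outer measure of the latter, restricted to its
   Caratheodory-measurable sets. *)
Definition cld_type : Type := caratheodory_type (pm^*)%mu.
HB.instance Definition _ := Measurable.on cld_type.

Definition cld_prod : set cld_type -> \bar R :=
  @completed_measure_extension _ _ _ pm.
HB.instance Definition _ := Measure.on cld_prod.

Lemma cld_prodE (S : set (X * Y)) : measurable S -> cld_prod S = pm S.
Proof. by move=> mS; exact: measurable_mu_extE. Qed.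

Lemma cld_prod_setT : cld_prod setT = 1%E.
Proof.
rewrite cld_prodE//= -setXTT product_measure1E//.
rewrite -[RHS](mule1 1%E); congr (_ * _)%E; exact: probability_setT.
Qed.

HB.instance Definition _ :=
  @Measure_isProbability.Build _ _ _ cld_prod cld_prod_setT.

Lemma cld_measurable (S : set (X * Y)) : measurable S ->
  measurable (S : set cld_type).
Proof. by move=> mS; exact: caratheodory_measurable_mu_ext. Qed.

Lemma cld_measurable_fun (h : X * Y -> R) :
  measurable_fun setT h -> measurable_fun setT (h : cld_type -> R).
Proof.
move=> mh _ B mB; rewrite setTI.
by apply: cld_measurable; have := mh measurableT B mB; rewrite setTI.
Qed.

Lemma cld_ae (P : set X) (Q : set Y) : {ae mu, forall x, P x} ->
  {ae nu, forall y, Q y} ->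
  {ae cld_prod, forall z : cld_type, P z.1 /\ Q z.2}.
Proof.
move=> [N [mN N0 PN]] [M [mM M0 QM]].
exists ((N `*` setT) `|` (setT `*` M)); split.
- by apply: cld_measurable; apply: measurableU; exact: measurableX.
- have mNT : measurable (N `*` [set: Y]) by exact: measurableX.
  have mTM : measurable ([set: X] `*` M) by exact: measurableX.
  rewrite cld_prodE; last exact: measurableU.
  apply/eqP; rewrite eq_le measure_ge0 andbT.
  have NT0 : pm (N `*` setT) = 0%E.
    transitivity (mu N * nu setT)%E; first exact: product_measure1E.
    by rewrite N0 mul0e.
  have TM0 : pm (setT `*` M) = 0%E.
    transitivity (mu setT * nu M)%E; first exact: product_measure1E.
    by rewrite M0 mule0.
  apply: (le_trans (measureU2 _ mNT mTM)).
  by rewrite [X in (X + _)%E]NT0 [X in (_ + X)%E]TM0 adde0.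
- move=> [x y] /= /not_andP[nP|nQ]; [left|right]; split => //=.
    exact: PN.
  exact: QM.
Qed.

Variables (f : L1u mu) (g : L1u nu).

Lemma tensor_measurable :
  measurable_fun setT (fun z : cld_type => (f z.1 : R) * (g z.2 : R)).
Proof.
apply: cld_measurable_fun; apply: measurable_funM.
  by apply: measurableT_comp; [exact: L1u_measurable|exact: measurable_fst].
by apply: measurableT_comp; [exact: L1u_measurable|exact: measurable_snd].
Qed.

Lemma tensor_itv : {ae cld_prod, forall z : cld_type,
  0 <= (f z.1 : R) * (g z.2 : R) <= 1}.
Proof.
apply: filterS (cld_ae (L1u_itv f) (L1u_itv g)) => z [].
by move=> /andP[f0 f1] /andP[g0 g1]; rewrite mulr_ge0//= mulr_ile1.
Qed.

Definition tensor : L1u cld_prod := L1u_class tensor_measurable tensor_itv.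

End product.

Arguments cld_prod {d1 d2 X Y R} mu nu.

Definition extremally_disconnected (X : topologicalType) : Prop :=
  forall U : set X, open U -> open (closure U).

(* (X_A, Omega_A, mu_A) together with the isomorphism of A^dc onto L_1(mu_A)_u.
   Measurable types are pointed, hence so is model_space; a probability space is
   nonempty anyway. *)
Record L1_model (R : realType) (A : mvType) (E : CX_embedding R A)
    (sA : state R A) := L1Model {
  model_space : ptopologicalType;
  model_compact : compact [set: model_space];
  model_hausdorff : hausdorff_space model_space;
  model_extremal : extremally_disconnected model_space;
  model_mu : probability (g_sigma_algebraType (@open model_space)) R;
  model_iso :> dcompl E sA -> L1u model_mu;
  model_bij : bijective model_iso;
  model_hom : mv_hom model_iso;
  model_scale : forall t p q, 0 <= t <= 1 -> dcompl_scale t p q ->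
    {ae model_mu, forall x, (model_iso q x : R) = t * model_iso p x};
  model_state : forall p, L1u_int (model_iso p) = dcompl_state p
}.

Section product_space.
Variables (R : realType) (A B : mvType).
Variables (EA : CX_embedding R A) (EB : CX_embedding R B).
Variables (sA : state R A) (sB : state R B).
Variables (LA : L1_model EA sA) (LB : L1_model EB sB).

Definition product_space : mvType :=
  L1u (cld_prod (model_mu LA) (model_mu LB)).
Definition product_state (f : product_space) : R := L1u_int f.
Definition product_beta (a : A) (b : B) : product_space :=
  tensor (LA (dcompl_in EA sA a)) (LB (dcompl_in EB sB b)).

End product_space.

(* Main.v *)
Require Import Defs.
From mathcomp Require Import all_boot all_order all_algebra.
From mathcomp Require Import all_classical all_reals all_analysis.
From mathcomp Require Import measurable_realfun.
From mathcomp Require Import ring lra.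

Set Implicit Arguments.
Unset Strict Implicit.
Unset Printing Implicit Defensive.

Import Order.TTheory GRing.Theory Num.Theory.
Import numFieldNormedType.Exports HBSimple.

Local Open Scope classical_set_scope.
Local Open Scope ring_scope.

(** Through the models, [A] and [B] are MV-algebras of functions on probability
    spaces, and [gamma] takes values in functions on a third one. The idea is to
    extend [gamma] to a positive operator from the whole space L1 of the product
    measure to the L1 space of the model of [C], and to restrict this operator
    to the unit interval, which is the product space.

    On an L1 space let [p u] be the integral of the negative part of [u]. A
    linear operator [w] is positive with norm at most [K] exactly when
    [p (w u) <= K * p u] for all [u]. If a family [u i] spans a dense subspace,
    such an operator with given values [v i] at the [u i] exists as soon as
    [p (\sum v - \sum v') <= K * p (\sum u - \sum u')] for all finite sums, since
    the estimate passes to the closure of the graph and L1 is complete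
    ([posop_extension], [L1_complete]). This is used three times.

    Firstly, every bounded linear map on an MV-algebra of functions whose span is
    dense extends to L1 ([linear_extension]). For the estimate, a sum of elements
    of the algebra can be reduced by an element, inside the algebra, so that the
    truncated difference is again a sum of elements, while a positive additive
    functional decreases at most by its value at that element
    ([scalar_estimate]). A vector-valued map is treated by integrating over an
    arbitrary set, because [p u] is attained as minus the integral of [u] over a
    set. Thus each [gamma (-) b] becomes an operator [w b] on the L1 space of the
    model of [A].

    Secondly, the values [w b (1_E)] prescribe the operator at the functions
    [1_E(x) f_b(y)], with [E] measurable. Given a finite sum of such functions,
    split the first space along the sets [E] that occur. On each piece the sum
    depends on [y] only, so that the one-variable estimate for [B] applies, and
    [p] is additive over the pieces ([rectangle_estimate]). The operator obtained
    takes the value [gamma a b] at [f_a(x) f_b(y)], because for fixed [b] it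
    agrees with [w b] on indicators, which are total ([bilinear_extension]). It
    preserves the unit interval because it maps the constant 1 to the image of
    [gamma 1 1].

    Thirdly, for uniqueness, a bounded linear map on the product space, which is
    itself an MV-algebra of functions, extends to L1 by the first step; two such
    extensions that agree at the products [f_a(x) f_b(y)] are equal, because
    these products are total ([tensor_total], [bounded_linear_unique]). Totality
    comes from the density of the divisible hull in the model ([model_total]),
    and from Dynkin's lemma together with the outer approximation of the
    measurable sets of the completed product ([tens_total]). *)

(** * Asymmetric seminorms *)

(** The example to keep in mind is the integral of the negative part on an
    L1 space. A bound [p (w x) <= K * p x] then says at once that [w] is
    positive (take [p x = 0]) and that it is bounded by [K] (add up the bounds
    at [x] and [- x]), so that one inequality controls both. *)
Record asymnorm (R : realType) (V : lmodType R) := AsymNorm {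
  asym_fun :> V -> R;
  asym_ge0 : forall u, 0 <= asym_fun u;
  asymD : forall u v, asym_fun (u + v) <= asym_fun u + asym_fun v;
  asymZ : forall c u, 0 <= c -> asym_fun (c *: u) = c * asym_fun u
}.

Section asymnorm_theory.
Variables (R : realType) (V : lmodType R) (p : asymnorm V).
Implicit Types (u v w : V) (D : V -> Prop).

Definition adist u v : R := p (u - v) + p (v - u).

Lemma asym0 : p 0 = 0.
Proof. by rewrite -(scale0r 0) asymZ// mul0r. Qed.

Lemma adist_ge0 u v : 0 <= adist u v.
Proof. by rewrite addr_ge0 ?asym_ge0. Qed.

Lemma adistC u v : adist u v = adist v u.
Proof. exact: addrC. Qed.

Lemma adistxx u : adist u u = 0.
Proof. by rewrite /adist subrr asym0 addr0. Qed.

Lemma adist_triangle v u w : adist u w <= adist u v + adist v w.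
Proof.
have -> : adist u v + adist v w =
  (p (u - v) + p (v - w)) + (p (w - v) + p (v - u)) by rewrite /adist; ring.
by apply: lerD; apply: (le_trans _ (asymD _ _ _)); rewrite addrA subrK.
Qed.

Lemma adistD u v u' v' : adist (u + u') (v + v') <= adist u v + adist u' v'.
Proof.
have -> : adist u v + adist u' v' =
  (p (u - v) + p (u' - v')) + (p (v - u) + p (v' - u')) by rewrite /adist; ring.
by apply: lerD; apply: (le_trans _ (asymD _ _ _));
  rewrite opprD [X in p X <= _]addrACA.
Qed.

Lemma adistN u v : adist (- u) (- v) = adist u v.
Proof. by rewrite /adist !opprK ![- _ + _]addrC [LHS]addrC. Qed.

Lemma adistZ c u v : adist (c *: u) (c *: v) = `|c| * adist u v.
Proof.
have pos c' u' v' : 0 <= c' -> adist (c' *: u') (c' *: v') = c' * adist u' v'.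
  move=> c0; by rewrite /adist -!scalerBr !asymZ// mulrDr.
have [c0|c0] := leP 0 c; first by rewrite pos ?ger0_norm.
by rewrite -adistN -!scaleNr pos ?oppr_ge0 ?ltr0_norm ?ltW.
Qed.

Lemma adist_scalel a b u : adist (a *: u) (b *: u) = `|a - b| * adist u 0.
Proof.
rewrite -adistZ scaler0 /adist -!scalerBl subr0 sub0r; congr (_ + p _).
by rewrite -scaleNr opprB.
Qed.

Lemma asym_le_adist u v : p u <= p v + adist u v.
Proof.
have := asymD p v (u - v); rewrite addrC subrK => /le_trans; apply.
by rewrite lerD2l lerDl asym_ge0.
Qed.

Lemma asym_adist0 u v : adist u v = 0 -> p u = p v.
Proof.
move=> uv; apply/eqP; rewrite eq_le.
have := asym_le_adist u v; have := asym_le_adist v u.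
by rewrite (adistC v) uv !addr0 => -> ->.
Qed.

Lemma adist0_trans v u w : adist u v = 0 -> adist v w = 0 -> adist u w = 0.
Proof.
move=> uv vw; apply/le_anti; rewrite adist_ge0 andbT.
by have := adist_triangle v u w; rewrite uv vw addr0.
Qed.

Lemma adist0D u v u' v' :
  adist u v = 0 -> adist u' v' = 0 -> adist (u + u') (v + v') = 0.
Proof.
move=> uv uv'; apply/le_anti; rewrite adist_ge0 andbT.
by have := adistD u v u' v'; rewrite uv uv' addr0.
Qed.

Lemma adist_eq0P u v : (forall e : R, 0 < e -> adist u v <= e) -> adist u v = 0.
Proof.
move=> h; apply/le_anti; rewrite adist_ge0 andbT.
by apply/ler_addgt0Pl => e e0; rewrite addr0; exact: h.
Qed.

(** Closedness is for the seminorm, so that a closed subspace contains with an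
    element all those at distance 0 from it. *)
Definition closed_subspace D : Prop :=
  [/\ D 0,
      forall u v, D u -> D v -> D (u + v),
      forall c u, D u -> D (c *: u) &
      forall u, (forall e : R, 0 < e -> exists2 v, D v & adist u v < e) -> D u].

Lemma closed_subspace_eq D u v :
  closed_subspace D -> adist u v = 0 -> D v -> D u.
Proof.
by move=> [_ _ _ cl] uv Dv; apply: cl => e e0; exists v; rewrite ?uv.
Qed.

Lemma closed_subspaceB D u v :
  closed_subspace D -> D u -> D v -> D (u - v).
Proof.
by move=> [_ DD DZ _] Du Dv; apply: DD => //; rewrite -scaleN1r; exact: DZ.
Qed.

Lemma closed_subspace_sum D (I : Type) (s : seq I) (F : I -> V) :
  closed_subspace D -> (forall i, D (F i)) -> D (\sum_(i <- s) F i).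
Proof.
move=> [D0 DD _ _] DF; elim: s => [|i s IH]; first by rewrite big_nil.
by rewrite big_cons; exact: DD.
Qed.

(** Having every vector in each closed subspace that contains a family is a way
    to say that the linear span of the family is dense. *)
Definition total_family (I : Type) (w : I -> V) : Prop :=
  forall D, closed_subspace D -> (forall i, D (w i)) -> forall u, D u.

(** Every Cauchy sequence has a subsequence that converges as fast as this. *)
Definition asym_complete : Prop :=
  forall u : nat -> V, (forall n, adist (u n.+1) (u n) <= 2^-1 ^+ n) ->
    exists v, forall e : R, 0 < e ->
      exists N, forall n, (N <= n)%N -> adist (u n) v <= e.

(** * Closed rational spans *)

Section span.
Variables (I : Type) (w : I -> V).

Definition comb (s t : seq I) : V := \sum_(i <- s) w i - \sum_(i <- t) w i.

Lemma comb_cat s t s' t' : comb (s ++ s') (t ++ t') = comb s t + comb s' t'.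
Proof. by rewrite /comb !big_cat/= opprD addrACA. Qed.

Lemma combN s t : comb t s = - comb s t.
Proof. by rewrite /comb opprB. Qed.

Lemma comb_muln n s t : exists s' t', comb s' t' = n%:R *: comb s t.
Proof.
elim: n => [|n [s' [t' E]]].
  by exists [::], [::]; rewrite /comb !big_nil subr0 scale0r.
exists (s ++ s'), (t ++ t'); rewrite comb_cat E -nat1r scalerDl scale1r//.
Qed.

(** The closure of the rational span: with the denominator [n] apart, the
    combinations have integral coefficients, and estimates are easier to prove
    for these. *)
Definition qspan (u : V) : Prop := forall e : R, 0 < e ->
  exists n s t, (0 < n)%N /\ adist u (n%:R^-1 *: comb s t) <= e.

Lemma qspan_mem i : qspan (w i).
Proof.
move=> e e0; exists 1%N, [:: i], [::]; split=> //.
by rewrite /comb big_seq1 big_nil subr0 invr1 scale1r adistxx ltW.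
Qed.

Lemma qspanD u v : qspan u -> qspan v -> qspan (u + v).
Proof.
move=> hu hv e e0; have e2 : 0 < e / 2 by rewrite divr_gt0.
have [n [s [t [n0 st]]]] := hu _ e2.
have [m [s' [t' [m0 st']]]] := hv _ e2.
have [a [b ab]] := comb_muln m s t; have [a' [b' ab']] := comb_muln n s' t'.
exists (n * m)%N, (a ++ a'), (b ++ b'); split; first by rewrite muln_gt0 n0.
have n0' : n%:R != 0 :> R by rewrite pnatr_eq0 -lt0n.
have m0' : m%:R != 0 :> R by rewrite pnatr_eq0 -lt0n.
rewrite comb_cat ab ab' scalerDr !scalerA natrM invfM mulfVK//.
rewrite mulrAC mulVf// mul1r.
by apply: le_trans (adistD _ _ _ _) _; rewrite (splitr e) lerD.
Qed.

Lemma qspanN u : qspan u -> qspan (- u).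
Proof.
move=> hu e /hu[n [s [t [n0 st]]]]; exists n, t, s; split=> //.
by rewrite combN scalerN adistN.
Qed.

Lemma qspan_lim u :
  (forall e : R, 0 < e -> exists2 v, qspan v & adist u v <= e) -> qspan u.
Proof.
move=> hu e e0; have e2 : 0 < e / 2 by rewrite divr_gt0.
have [v hv uv] := hu _ e2; have [n [s [t [n0 st]]]] := hv _ e2.
exists n, s, t; split=> //; apply: le_trans (adist_triangle v _ _) _.
by rewrite (splitr e) lerD.
Qed.

Lemma qspan_rat (k m : nat) u : (0 < m)%N -> qspan u ->
  qspan ((k%:R / m%:R) *: u).
Proof.
move=> m0 hu; suff hm : qspan (m%:R^-1 *: u).
  elim: k => [|k IH]; last by rewrite -nat1r mulrDl mul1r scalerDl; exact: qspanD.
  by rewrite mul0r scale0r -(subrr u); apply: qspanD => //; exact: qspanN.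
have m0' : 0 < m%:R :> R by rewrite ltr0n.
move=> e e0; have me0 : 0 < m%:R * e by rewrite mulr_gt0.
have [n [s [t [n0 st]]]] := hu _ me0.
exists (m * n)%N, s, t; split; first by rewrite muln_gt0 m0.
rewrite natrM invfM -scalerA adistZ ger0_norm ?invr_ge0 ?ler0n//.
by rewrite ler_pdivrMl.
Qed.

Lemma qspanZ c u : qspan u -> qspan (c *: u).
Proof.
move=> hu; suff pos c' : 0 <= c' -> qspan (c' *: u).
  have [/pos//|c0] := leP 0 c; rewrite -[c]opprK scaleNr.
  by apply/qspanN/pos; rewrite oppr_ge0 ltW.
move=> c0; apply: qspan_lim => e e0.
have [m hm] : exists m : nat, (adist u 0) / e < m.+1%:R.
  exists (Num.trunc (adist u 0 / e)).
  exact: truncnS_gt.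
have m0 : 0 < m.+1%:R :> R by rewrite ltr0n.
(* [k / (m + 1)] approximates [c'] from below *)
pose k := Num.trunc (c' * m.+1%:R).
exists ((k%:R / m.+1%:R) *: u); first exact: qspan_rat.
rewrite adist_scalel.
have cm0 : 0 <= c' * m.+1%:R by rewrite mulr_ge0 ?ler0n.
have /andP[k1 k2] := truncn_itv cm0.
have ck : `|c' - k%:R / m.+1%:R| <= m.+1%:R^-1.
  rewrite ger0_norm ?subr_ge0 ?ler_pdivrMr//.
  rewrite lerBlDr -[X in X + _]mul1r -mulrDl ler_pdivlMr//.
  by rewrite nat1r ltW.
apply: le_trans (ler_wpM2r (adist_ge0 _ _) ck) _.
by rewrite ler_pdivrMl// mulrC -ler_pdivrMl// mulrC ltW.
Qed.

Lemma qspan_closed_subspace : closed_subspace qspan.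
Proof.
split.
- move=> e e0; exists 1%N, [::], [::]; split=> //.
  by rewrite /comb !big_nil subr0 scaler0 adistxx ltW.
- exact: qspanD.
- exact: qspanZ.
- move=> u hu; apply: qspan_lim => e /hu[v hv /ltW uv]; by exists v.
Qed.

End span.

End asymnorm_theory.

(** For a bounded linear map [f] totality can be tested in the source: this moves
    density from the factors of a tensor product to the product. *)
Lemma closed_subspace_preim (R : realType) (V V' : lmodType R)
    (p : asymnorm V) (q : asymnorm V') (c : R) (f : V' -> V) (D : V -> Prop) :
  0 <= c -> (forall x y, f (x + y) = f x + f y) ->
  (forall a x, f (a *: x) = a *: f x) ->
  (forall x y, adist p (f x) (f y) <= c * adist q x y) ->
  closed_subspace p D -> closed_subspace q (fun x => D (f x)).
Proof.
move=> c0 fD fZ f_le [D0 DD DZ clD]; split.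
- by have := fZ 0 0; rewrite !scale0r => ->.
- by move=> x y Dx Dy; rewrite fD; exact: DD.
- by move=> a x Dx; rewrite fZ; exact: DZ.
- move=> x hx; apply: clD => e e0.
  have c1 : 0 < c + 1 by rewrite ltr_wpDl.
  have [y Dy xy] := hx _ (divr_gt0 e0 c1); exists (f y) => //.
  apply: le_lt_trans (f_le x y) _; rewrite ltr_pdivlMr// mulrDr mulr1 mulrC in xy.
  by apply: le_lt_trans xy; rewrite lerDl adist_ge0.
Qed.
(** * Extension of positive operators *)

(** A bounded positive linear operator between spaces of functions taken almost
    everywhere: [w] acts on the functions themselves, hence it is linear only up
    to functions at distance 0. *)
Record posop (R : realType) (V W : lmodType R) (p : asymnorm V)
    (q : asymnorm W) (K : R) (w : V -> W) : Prop := PosOp {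
  posopD : forall x y, adist q (w (x + y)) (w x + w y) = 0;
  posopZ : forall c x, adist q (w (c *: x)) (c *: w x) = 0;
  posop_bound : forall x, q (w x) <= K * p x
}.

Section posop_theory.
Variables (R : realType) (V W : lmodType R) (p : asymnorm V) (q : asymnorm W).
Variables (K : R) (w : V -> W).
Hypothesis hw : posop p q K w.

Lemma posop_asym (x : V) (y : W) : adist q (w x) y = 0 -> q y <= K * p x.
Proof. by move/asym_adist0 => <-; exact: (posop_bound hw). Qed.

Lemma posopN x : adist q (w (- x)) (- w x) = 0.
Proof. by have := posopZ hw (-1) x; rewrite !scaleN1r. Qed.

Lemma posopB x y : adist q (w (x - y)) (w x - w y) = 0.
Proof.
apply: (adist0_trans (posopD hw _ _)); apply: adist0D; first exact: adistxx.
exact: posopN.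
Qed.

Lemma posop_adist x y : adist q (w x) (w y) <= K * adist p x y.
Proof.
rewrite /adist mulrDr; apply: lerD.
  by apply: posop_asym; exact: posopB.
by apply: posop_asym; exact: posopB.
Qed.

Lemma posop_adist0 x y : adist p x y = 0 -> adist q (w x) (w y) = 0.
Proof.
move=> xy; apply/le_anti; rewrite adist_ge0 andbT.
by have := posop_adist x y; rewrite xy mulr0.
Qed.

End posop_theory.

Section posop_pairs.
Variables (R : realType) (V W : lmodType R) (p : asymnorm V) (q : asymnorm W).
Implicit Types (K : R) (w : V -> W).

(** For operators that agree on a total family this gives agreement everywhere, up
    to distance 0. *)
Lemma posop_equalizer K K' w w' : 0 <= K -> 0 <= K' ->
  posop p q K w -> posop p q K' w' ->
  closed_subspace p (fun x => adist q (w x) (w' x) = 0).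
Proof.
move=> K0 K'0 hw hw'; split.
- have w0 K1 w1 : posop p q K1 w1 -> adist q (w1 0) 0 = 0.
    by move=> h; have := posopZ h 0 0; rewrite !scale0r.
  by apply: (adist0_trans (w0 _ _ hw)); rewrite adistC; exact: w0 hw'.
- move=> x y ex ey; apply: (adist0_trans (posopD hw _ _)).
  by apply: (adist0_trans (adist0D ex ey)); rewrite adistC; exact: (posopD hw').
- move=> c x ex; apply: (adist0_trans (posopZ hw _ _)).
  apply: (@adist0_trans _ _ _ (c *: w' x)); first by rewrite adistZ ex mulr0.
  by rewrite adistC; exact: (posopZ hw').
- move=> x hx; apply: adist_eq0P => e e0.
  have Kp : 0 < K + K' + 1 by rewrite ltr_wpDl ?addr_ge0.
  have [y ey /ltW xy] := hx _ (divr_gt0 e0 Kp).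
  have h1 := posop_adist hw x y; have h2 := posop_adist hw' y x.
  apply: le_trans (adist_triangle _ (w y) _ _) _.
  have h3 := adist_triangle q (w' y) (w y) (w' x); rewrite ey add0r in h3.
  apply: le_trans (lerD h1 (le_trans h3 h2)) _.
  rewrite (adistC p y) -mulrDl.
  apply: le_trans (ler_wpM2l (addr_ge0 K0 K'0) xy) _.
  rewrite mulrA ler_pdivrMr// mulrC; apply: ler_wpM2l; first exact: ltW.
  by rewrite lerDl ler01.
Qed.

Lemma posop_add K K' w w' : posop p q K w -> posop p q K' w' ->
  posop p q (K + K') (fun x => w x + w' x).
Proof.
move=> hw hw'; split=> [x y|c x|x].
- by rewrite addrACA; apply: adist0D; [exact: (posopD hw)|exact: (posopD hw')].
- by rewrite scalerDr; apply: adist0D; [exact: (posopZ hw)|exact: (posopZ hw')].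
- rewrite mulrDl; apply: le_trans (asymD _ _ _) _.
  by apply: lerD; [exact: (posop_bound hw)|exact: (posop_bound hw')].
Qed.

End posop_pairs.

Section extension.
Variables (R : realType) (V W : lmodType R) (p : asymnorm V) (q : asymnorm W).

Let pq (z : V * W) : R := p z.1 + q z.2.

Let pq_ge0 z : 0 <= pq z. Proof. by rewrite addr_ge0 ?asym_ge0. Qed.
Let pqD y z : pq (y + z) <= pq y + pq z.
Proof. by rewrite [leRHS]addrACA lerD ?asymD. Qed.
Let pqZ c z : 0 <= c -> pq (c *: z) = c * pq z.
Proof. by move=> c0; rewrite /pq mulrDr !asymZ. Qed.

Definition asymnorm_prod : asymnorm (V * W)%type := AsymNorm pq_ge0 pqD pqZ.

Lemma adist_prod y z :
  adist asymnorm_prod y z = adist p y.1 z.1 + adist q y.2 z.2.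
Proof. by rewrite /adist/= addrACA. Qed.

Variables (I : Type) (u : I -> V) (v : I -> W) (K : R).
Hypotheses (K0 : 0 <= K)
  (uv : forall s t, q (comb v s t) <= K * p (comb u s t)).

Let graph (x : V) (y : W) : Prop :=
  qspan asymnorm_prod (fun i => (u i, v i)) (x, y).

Let graph_closed : closed_subspace asymnorm_prod (fun z => graph z.1 z.2).
Proof.
have -> : (fun z : V * W => graph z.1 z.2) =
    qspan asymnorm_prod (fun i => (u i, v i)) by apply/funext => -[].
exact: qspan_closed_subspace.
Qed.

Let comb_pair s t : comb (fun i => (u i, v i)) s t = (comb u s t, comb v s t).
Proof.
have sum r : \sum_(i <- r) (u i, v i) = (\sum_(i <- r) u i, \sum_(i <- r) v i).
  by elim: r => [|i r IH]; rewrite ?big_nil// !big_cons IH.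
by rewrite /comb !sum.
Qed.

Let graph_bound x y : graph x y -> q y <= K * p x.
Proof.
move=> xy; apply/ler_addgt0Pl => e e0.
have K1 : 0 < K + 1 by rewrite ltr_wpDl.
have [n [s [t [n0]]]] := xy _ (divr_gt0 e0 K1).
rewrite comb_pair adist_prod /= => h.
have n0' : 0 <= n%:R^-1 :> R by rewrite invr_ge0 ler0n.
have h1 := asym_le_adist q y (n%:R^-1 *: comb v s t).
have h2 := asym_le_adist p (n%:R^-1 *: comb u s t) x.
have /(ler_wpM2l n0') h3 := uv s t.
rewrite !asymZ// in h1 h2; rewrite mulrCA in h3.
rewrite adistC in h2.
have /(ler_wpM2l K0) h2' := h2.
have d1 := adist_ge0 p x (n%:R^-1 *: comb u s t).
have d2 := adist_ge0 q y (n%:R^-1 *: comb v s t).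
have h4 : (K + 1) * (adist p x (n%:R^-1 *: comb u s t)
  + adist q y (n%:R^-1 *: comb v s t)) <= e by rewrite mulrC -ler_pdivlMr.
have := mulr_ge0 K0 d2.
move: h1 h2' h3 h4 d1 d2; move: (adist p _ _) (adist q _ _) => a b.
rewrite !mulrDr !mulrDl; lra.
Qed.

Let graph_adist x y x' y' : graph x y -> graph x' y' ->
  adist q y y' <= K * adist p x x'.
Proof.
move=> xy xy'.
have B a b a' b' : graph a b -> graph a' b' -> graph (a - a') (b - b').
  move=> ab ab'.
  by have := closed_subspaceB (u := (a, b)) (v := (a', b')) graph_closed ab ab'.
by rewrite /adist mulrDr; apply: lerD; apply: graph_bound; exact: B.
Qed.

Let graph_dom_closed : asym_complete q ->
  closed_subspace p (fun x => exists y, graph x y).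
Proof.
have [g0 gD gZ gcl] := graph_closed.
move=> cq; split.
- by exists 0; exact: g0.
- by move=> x x' [y xy] [y' xy']; exists (y + y'); exact: (gD (x, y) (x', y')).
- by move=> c x [y xy]; exists (c *: y); exact: (gZ c (x, y)).
move=> x hx.
have K1 : 0 < 2 * (K + 1) by rewrite mulr_gt0// ltr_wpDl.
(* approximations so close to [x] that their images converge fast *)
have /choice[f hf] n : exists z : V * W,
    graph z.1 z.2 /\ adist p x z.1 <= 2^-1 ^+ n / (2 * (K + 1)).
  have e0 : 0 < (2^-1 : R) ^+ n / (2 * (K + 1)).
    by rewrite divr_gt0 ?exprn_gt0 ?invr_gt0.
  by have [x' [y' xy'] /ltW] := hx _ e0; exists (x', y').
have [y hy] : exists y, forall e : R, 0 < e ->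
    exists N, forall n, (N <= n)%N -> adist q (f n).2 y <= e.
  apply: cq => n; have [g1 d1] := hf n; have [g2 d2] := hf n.+1.
  apply: le_trans (graph_adist g2 g1) _.
  have d3 := adist_triangle p x (f n.+1).1 (f n).1.
  rewrite (adistC p _ x) in d3.
  have d4 : adist p x (f n.+1).1 <= 2^-1 ^+ n / (2 * (K + 1)).
    apply: le_trans d2 _; rewrite ler_pM2r ?invr_gt0// exprS.
    by rewrite ler_piMl ?exprn_ge0 ?invr_ge0// invf_le1// ler1n.
  apply: le_trans (ler_wpM2l K0 (le_trans d3 (lerD d4 d1))) _.
  have K1' : 0 < K + 1 by rewrite ltr_wpDl.
  have a0 : 0 <= 2^-1 ^+ n :> R by rewrite exprn_ge0 ?invr_ge0.
  move: (2^-1 ^+ n) a0 => a a0.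
  have -> : K * (a / (2 * (K + 1)) + a / (2 * (K + 1))) = a * (K / (K + 1)).
    by field; rewrite gt_eqF.
  by apply: ler_piMr => //; rewrite ler_pdivrMr// mul1r lerDl.
exists y; apply: (gcl (x, y)) => e e0.
have e2 : 0 < e / 3 by rewrite divr_gt0.
have [N hN] := hy _ e2.
have [M hM] : exists M, forall n, (M <= n)%N -> 2^-1 ^+ n / (2 * (K + 1)) <= e / 3.
  exists (Num.trunc (3 / e)) => n Mn.
  have : 2^-1 ^+ n <= e / 3.
    rewrite exprVn invf_ple ?posrE ?exprn_gt0// invf_div.
    apply: le_trans (ltW (truncnS_gt _)) _.
    rewrite -natrX ler_nat; apply: (leq_ltn_trans Mn); exact: ltn_expl.
  apply: le_trans; rewrite ler_pdivrMr//.
  apply: ler_peMr; rewrite ?exprn_ge0 ?invr_ge0//.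
  by move: K0 => {K1 e0 e2}; lra.
exists (f (maxn N M)); first by have [] := hf (maxn N M).
rewrite adist_prod /= (adistC q).
have [_ /le_trans d1] := hf (maxn N M).
apply: (@le_lt_trans _ _ (e / 3 + e / 3)).
  apply: lerD; last by apply: hN; rewrite leq_maxl.
  by apply: d1; apply: hM; rewrite leq_maxr.
lra.
Qed.

(** The closure of the linear relation spanned by the pairs [(u i, v i)] is the
    graph of an operator: the estimate survives in the closure, which makes the
    relation functional, and completeness of the target makes its domain
    closed, hence everything. *)
Lemma posop_extension : asym_complete q -> total_family p u ->
  exists2 w, posop p q K w & forall i, adist q (w (u i)) (v i) = 0.
Proof.
move=> cq tu; have [g0 gD gZ gcl] := graph_closed.
have u_graph i : graph (u i) (v i).
  exact: (qspan_mem asymnorm_prod (fun i => (u i, v i))).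
have /choice[w hw] : forall x, exists y, graph x y.
  by apply: tu; [exact: graph_dom_closed|move=> i; exists (v i)].
have eq x y : graph x y -> adist q (w x) y = 0.
  move=> xy; apply/le_anti; rewrite adist_ge0 andbT.
  by have := graph_adist (hw x) xy; rewrite adistxx mulr0.
exists w; last by move=> i; exact: eq.
split=> [x y|c x|x].
- by apply: eq; exact: (gD (x, w x) (y, w y)).
- by apply: eq; exact: (gZ c (x, w x)).
- exact: graph_bound.
Qed.

End extension.

(** * The space of integrable functions *)

Notation L1 mu := (LfunType mu (@lexx _ _ (1%E : \bar _))).

Definition negpart {R : realType} (r : R) : R := Num.max (- r) 0.

Lemma negpart_ge0 (R : realType) (r : R) : 0 <= negpart r.
Proof. by rewrite le_max lexx orbT. Qed.

Lemma negpart_le_norm (R : realType) (r : R) : negpart r <= `|r|.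
Proof. by rewrite ge_max normr_ge0 andbT -normrN ler_norm. Qed.

Section L1_space.
Context d (T : measurableType d) (R : realType) (mu : probability T R).
Implicit Types u v : L1 mu.

Lemma L1_integrable u : mu.-integrable setT (EFin \o u).
Proof. by have /Lfun1_integrable := LfunP u. Qed.

Lemma L1_measurable u : measurable_fun setT u.
Proof. by have /measurable_int/measurable_EFinP := L1_integrable u. Qed.

Lemma mem_Lfun1 (f : T -> R) :
  mu.-integrable setT (EFin \o f) -> f \in Lfun mu 1.
Proof. by move/Lfun1_integrable. Qed.

Definition L1_of (f : T -> R) (fi : mu.-integrable setT (EFin \o f)) : L1 mu :=
  Lfun_Sub _ (mem_Lfun1 fi).

Lemma L1_ofE f (fi : mu.-integrable setT (EFin \o f)) x : L1_of fi x = f x.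
Proof. by []. Qed.

Lemma L1DE u v x : (u + v) x = u x + v x. Proof. by []. Qed.
Lemma L1NE u x : (- u) x = - u x. Proof. by []. Qed.
Lemma L1BE u v x : (u - v) x = u x - v x. Proof. by []. Qed.
Lemma L1ZE c u x : (c *: u) x = c * u x. Proof. by []. Qed.
Lemma L10E x : (0 : L1 mu) x = 0. Proof. by []. Qed.
Lemma L1_sumE (I : Type) (s : seq I) (F : I -> L1 mu) x :
  (\sum_(i <- s) F i) x = \sum_(i <- s) F i x.
Proof. by elim: s => [|i s IH]; rewrite ?big_nil// !big_cons L1DE IH. Qed.

Lemma integrable_negpart u : mu.-integrable setT (EFin \o (negpart \o u)).
Proof.
apply: le_integrable (L1_integrable u) => //.
  apply/measurable_EFinP; apply: measurable_maxr => //.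
  by apply: measurableT_comp => //; exact: L1_measurable.
by move=> x _ /=; rewrite lee_fin ger0_norm ?negpart_ge0// negpart_le_norm.
Qed.

Lemma measurable_negpart u : measurable_fun setT (negpart \o u).
Proof. by have /measurable_int/measurable_EFinP := integrable_negpart u. Qed.

Let nrm u : R := \int[mu]_x negpart (u x).

Let nrm_ge0 u : 0 <= nrm u.
Proof. by apply: Rintegral_ge0 => x _; exact: negpart_ge0. Qed.

Let nrmD u v : nrm (u + v) <= nrm u + nrm v.
Proof.
rewrite -RintegralD//; [|exact: integrable_negpart..].
apply: le_Rintegral => //; first exact: integrable_negpart.
  under eq_fun do rewrite /=.
  exact: integrableD (integrable_negpart u) (integrable_negpart v).
move=> x _; rewrite /negpart L1DE !maxEle.
by case: (leP (- u x) 0); case: (leP (- v x) 0);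
  case: (leP (- (u x + v x)) 0); lra.
Qed.

Let nrmZ c u : 0 <= c -> nrm (c *: u) = c * nrm u.
Proof.
move=> c0; rewrite /nrm -RintegralZl//; last exact: integrable_negpart.
by apply: eq_Rintegral => x _; rewrite L1ZE /negpart -mulrN maxr_pMr// mulr0.
Qed.

(** By [L1distE] the associated distance is the L1 distance. *)
Definition L1neg : asymnorm (L1 mu) := AsymNorm nrm_ge0 nrmD nrmZ.

Lemma L1negE u : L1neg u = \int[mu]_x negpart (u x).
Proof. by []. Qed.

Lemma L1neg_EFin u : (L1neg u)%:E = (\int[mu]_x (negpart (u x))%:E)%E.
Proof.
by rewrite L1negE fineK// integrable_fin_num//; exact: integrable_negpart.
Qed.

Lemma L1neg_le_ae u v : {ae mu, forall x, negpart (u x) <= negpart (v x)} ->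
  L1neg u <= L1neg v.
Proof.
move=> uv; rewrite -lee_fin !L1neg_EFin; apply: ae_ge0_le_integral => //.
- by move=> x _; rewrite lee_fin negpart_ge0.
- by have /measurable_int := integrable_negpart u.
- by move=> x _; rewrite lee_fin negpart_ge0.
- by have /measurable_int := integrable_negpart v.
- by apply: filterS uv => x uvx _; rewrite lee_fin.
Qed.

Lemma L1neg_le u v : {ae mu, forall x, u x <= v x} -> L1neg v <= L1neg u.
Proof.
move=> uv; apply: L1neg_le_ae; apply: filterS uv => x uvx.
by rewrite /negpart ge_max !le_max lerN2 uvx/= lexx orbT.
Qed.

Lemma L1neg_eq0 u : L1neg u = 0 <-> {ae mu, forall x, 0 <= u x}.
Proof.
split=> [u0|u0]; last first.
  apply/le_anti; rewrite asym_ge0 andbT -(asym0 L1neg); exact: L1neg_le.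
have mu_ : measurable_fun setT (EFin \o (negpart \o u)).
  by have /measurable_int := integrable_negpart u.
have : (\int[mu]_x `|(EFin \o (negpart \o u)) x|)%E = 0%E.
  rewrite -[RHS](congr1 EFin u0) L1neg_EFin; apply: eq_integral => x _.
  by rewrite gee0_abs// lee_fin negpart_ge0.
move/(ae_eq_integral_abs mu measurableT mu_); apply: filterS => x /(_ I) /=.
move=> [] nux; rewrite -oppr_le0; apply: le_trans (_ : negpart (u x) <= 0).
  by rewrite le_max lexx.
by rewrite nux.
Qed.

Lemma L1dist_eq0 u v : adist L1neg u v = 0 <-> {ae mu, forall x, u x = v x}.
Proof.
split=> [uv|uv].
  have [uv1 uv2] : L1neg (u - v) = 0 /\ L1neg (v - u) = 0.
    have := uv; rewrite /adist.
    have := asym_ge0 L1neg (u - v); have := asym_ge0 L1neg (v - u).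
    by move=> a b ab; split; lra.
  move/L1neg_eq0: uv1; move/L1neg_eq0: uv2; apply: filterS2 => x.
  by rewrite !L1BE !subr_ge0 => a b; apply/le_anti/andP.
have half (a b : L1 mu) : {ae mu, forall x, a x = b x} -> L1neg (a - b) = 0.
  move=> ab; apply/L1neg_eq0; apply: filterS ab => x.
  by rewrite L1BE subr_ge0 => ->.
rewrite /adist (half u v uv) add0r; apply: half.
by apply: filterS uv => x ->.
Qed.

Lemma L1distE u v : adist L1neg u v = \int[mu]_x `|u x - v x|.
Proof.
rewrite /adist !L1negE -RintegralD//; [|exact: integrable_negpart..].
apply: eq_Rintegral => x _; rewrite !L1BE /negpart !maxEle.
move: (u x) (v x) => a b.
by have [ab|ab] := lerP a b; case: (leP (- (a - b)) 0);
  case: (leP (- (b - a)) 0); lra.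
Qed.

Lemma L1dist_EFin u v :
  (adist L1neg u v)%:E = (\int[mu]_x `|(u x)%:E - (v x)%:E|)%E.
Proof.
rewrite L1distE fineK//; apply: integrable_fin_num => //.
exact: integrable_abse (L1_integrable (u - v)).
Qed.

Lemma L1dist_integral u v :
  (adist L1neg u v)%:E = (\int[mu]_x (`|u x - v x|)%:E)%E.
Proof. exact: L1dist_EFin. Qed.

Lemma L1dist0_EFin u : (adist L1neg u 0)%:E = (\int[mu]_x (`|u x|)%:E)%E.
Proof.
rewrite L1dist_integral; apply: eq_integral => x _.
by rewrite -[X in (`|X|)%:E]/(u x - 0) subr0.
Qed.

Definition L1int u (G : set T) : R := \int[mu]_(x in G) u x.

Lemma integrable_on u (G : set T) : measurable G ->
  mu.-integrable G (EFin \o u).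
Proof. by move=> mG; apply: integrableS (L1_integrable u). Qed.

Lemma L1intD u v G : measurable G -> L1int (u + v) G = L1int u G + L1int v G.
Proof.
by move=> mG; rewrite -RintegralD//; exact: integrable_on.
Qed.

Lemma L1intZ c u G : measurable G -> L1int (c *: u) G = c * L1int u G.
Proof.
by move=> mG; rewrite -RintegralZl//; exact: integrable_on.
Qed.

Lemma L1intN u G : measurable G -> L1int (- u) G = - L1int u G.
Proof. by move=> mG; rewrite -scaleN1r L1intZ// mulN1r. Qed.

Lemma L1intB u v G : measurable G -> L1int (u - v) G = L1int u G - L1int v G.
Proof. by move=> mG; rewrite L1intD// L1intN. Qed.

Lemma L1int_sum (I : Type) (s : seq I) (F : I -> L1 mu) G : measurable G ->
  L1int (\sum_(i <- s) F i) G = \sum_(i <- s) L1int (F i) G.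
Proof.
move=> mG; elim: s => [|i s IH]; last by rewrite !big_cons L1intD// IH.
by rewrite !big_nil -(scale0r 0) L1intZ// mul0r.
Qed.

(** The positive part of [u] and the part of [u] outside [G] are discarded. *)
Lemma L1int_ge u G : measurable G -> - L1neg u <= L1int u G.
Proof.
move=> mG; rewrite lerNl -L1intN// /L1int.
apply: (@le_trans _ _ (\int[mu]_(x in G) negpart (u x))).
  apply: le_Rintegral => //; first exact: integrable_on.
    by apply: integrableS (integrable_negpart u).
  by move=> x _; rewrite L1NE /negpart le_max lexx.
rewrite Rintegral_mkcond L1negE.
have mr : mu.-integrable setT (EFin \o ((negpart \o u) \_ G)).
  by rewrite -restrict_EFin; apply/integrable_restrict => //; rewrite setTI;
    apply: integrableS (integrable_negpart u).
apply: le_Rintegral => //; first exact: integrable_negpart.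
by move=> x _; rewrite patchE; case: ifP => // _; exact: negpart_ge0.
Qed.

(** Together with [L1int_ge], this reduces estimates of the seminorm to estimates
    of scalar additive functionals. *)
Lemma L1neg_attained u : exists2 G, measurable G & L1neg u = - L1int u G.
Proof.
have mneg : measurable [set x | u x < 0].
  have := L1_measurable u measurableT (measurable_itv `]-oo, (0 : R)[).
  by rewrite setTI set_itvE.
exists [set x | u x < 0] => //; rewrite -L1intN//.
rewrite L1negE /L1int [RHS]Rintegral_mkcond; apply: eq_Rintegral => x _.
rewrite patchE /negpart L1NE; case: ifPn => [|]; rewrite ?inE ?notin_setE/=.
  by move=> ux; rewrite max_l// oppr_ge0 ltW.
by move=> /negP; rewrite -leNgt => ux; rewrite max_r// oppr_le0.
Qed.

Lemma L1int_adist0 u v G : measurable G -> adist L1neg u v = 0 ->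
  L1int u G = L1int v G.
Proof.
move=> mG uv; have := asym_adist0 (adist0D uv (adistxx L1neg (- v))).
have := asym_adist0 (adist0D (adistxx L1neg (- u)) uv).
rewrite subrr addNr asym0 => vu0 uv0.
have := L1int_ge (u - v) mG; have := L1int_ge (- u + v) mG.
rewrite -vu0 uv0 L1intB// L1intD// L1intN//; lra.
Qed.

Lemma L1int_ge0 u G : measurable G -> {ae mu, forall x, 0 <= u x} ->
  0 <= L1int u G.
Proof.
by move=> mG /L1neg_eq0 u0; have := L1int_ge u mG; rewrite u0 oppr0.
Qed.

Lemma L1int_le_neg u G : measurable G -> L1int u G <= L1neg (- u).
Proof. by move=> mG; have := L1int_ge (- u) mG; rewrite L1intN// lerN2. Qed.

Lemma L1negN u : {ae mu, forall x, 0 <= u x} -> L1neg (- u) = L1int u setT.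
Proof.
move=> u0; apply/eqP; rewrite eq_le L1int_le_neg// andbT.
have [G mG ->] := L1neg_attained (- u); rewrite L1intN// opprK.
have := L1int_ge0 (measurableC mG) u0.
suff -> : L1int u setT = L1int u G + L1int u (~` G) by rewrite lerDl.
rewrite /L1int -Rintegral_setU ?setUv//.
- exact: measurableC.
- exact: L1_integrable.
- by apply/disj_setPCl; exact: subset_refl.
Qed.

(** Along a fast Cauchy sequence the increments have an integrable sum, so that
    the sequence converges almost everywhere, and dominated convergence
    applies. *)
Lemma L1_complete : asym_complete L1neg.
Proof.
move=> u cu; pose D n x : \bar R := (`|u n.+1 x - u n x|)%:E.
have mD n : measurable_fun setT (D n).
  apply/measurable_EFinP; apply: measurableT_comp => //.
  by apply: measurable_funB; exact: L1_measurable.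
pose h x := (\sum_(n <oo) D n x)%E.
have D0 n x : (0 <= D n x)%E by rewrite lee_fin.
have mh : measurable_fun setT h by exact: ge0_emeasurable_sum.
have ih : mu.-integrable setT h.
  apply/integrableP; split=> //.
  under eq_integral do rewrite gee0_abs ?nneseries_ge0//.
  rewrite integral_nneseries//.
  apply: (@le_lt_trans _ _ (\sum_(n <oo) (2^-1 ^+ n : R)%:E)%E).
    apply: lee_nneseries => [n _ _|n _]; first exact: integral_ge0.
    by rewrite /D -L1dist_EFin lee_fin.
  apply: (@le_lt_trans _ _ 2%:E); last exact: ltry.
  apply: lime_le; first exact: is_cvg_nneseries.
  apply: nearW => n; rewrite sumEFin lee_fin.
  apply: (@le_trans _ _ (series (geometric 1 2^-1) n)).
    by rewrite /series/=; apply: ler_sum => k _; rewrite mul1r.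
  apply: le_trans (geometric_le_lim _ _ _ _) _ => //.
    by rewrite ger0_norm// invf_lt1// ltr1n.
  by rewrite mul1r (_ : 1 - 2^-1 = 2^-1) ?invrK//; lra.
have [good] : exists G : set T, [/\ measurable G, {ae mu, forall x, G x} &
    forall x, G x -> h x \is a fin_num].
  exists [set x | h x \is a fin_num]; split=> //.
    by have := emeasurable_fin_num measurableT mh; rewrite setTI.
  by have := integrable_ae measurableT ih; apply: filterS => x /(_ I).
move=> [mG aeG hG].
have bnd x : good x -> forall n,
    \sum_(0 <= k < n) `|u k.+1 x - u k x| <= fine (h x).
  move=> Gx n; rewrite -lee_fin fineK ?hG// -sumEFin.
  exact: (@nneseries_lim_ge _ (D ^~ x) xpredT 0%N).
(* the sequence converges on [good]; elsewhere it is replaced by 0 *)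
pose u' n x : R := u n x * \1_good x.
have u'_cvg x : cvgn (u' ^~ x).
  have [Gx|nGx] := pselect (good x); last first.
    under eq_fun => n do rewrite /u' indicE memNset// mulr0.
    exact: is_cvg_cst.
  pose dx (k : nat) : R^o := u k.+1 x - u k x.
  have cd : cvgn (series dx).
    apply: normed_cvg; apply: nondecreasing_is_cvgn.
      by apply: nondecreasing_series => k _ _; exact: normr_ge0.
    by exists (fine (h x)) => _ [n _ <-]; exact: bnd.
  have -> : u' ^~ x = (fun n => u 0%N x + series dx n).
    apply/funext => n; rewrite /u' indicE mem_set// mulr1.
    by rewrite /series/= telescope_sumr// addrC subrK.
  by apply: is_cvgD => //; exact: is_cvg_cst.
pose f x := limn (u' ^~ x).
have mu' n : measurable_fun setT (u' n).
  by apply: measurable_funM => //; exact: L1_measurable.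
have mf : measurable_fun setT f by apply: (measurable_fun_cvg mu') => x _.
have f_lim x : good x -> (EFin (u n x)) @[n --> \oo] --> EFin (f x).
  move=> Gx; apply: cvg_EFin; first exact: nearW.
  have -> : (fine \o (fun n => EFin (u n x))) = u' ^~ x.
    by apply/funext => n /=; rewrite /u' indicE mem_set// mulr1.
  exact: u'_cvg.
pose g x := ((`|u 0%N x|)%:E + h x)%E.
have ig : mu.-integrable setT g.
  by apply: integrableD => //; exact: integrable_abse (L1_integrable _).
have fg : {ae mu, forall x n, [set: T] x -> (`|(EFin \o u n) x| <= g x)%E}.
  apply: filterS aeG => x Gx n _ /=; rewrite /g -(fineK (hG _ Gx)) -EFinD lee_fin.
  rewrite -lerBlDl; apply: le_trans (bnd x Gx n).
  rewrite lerBlDr addrC; apply: le_trans (lerD (lexx _) (ler_norm_sum _ _ _)).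
  by rewrite telescope_sumr//; apply: le_trans (ler_normD _ _); rewrite addrC subrK.
have mun n : measurable_fun setT (EFin \o u n).
  by have /measurable_int := L1_integrable (u n).
have ff : {ae mu, forall x, [set: T] x ->
    (fun n => EFin \o u n) ^~ x @ \oo --> (EFin \o f) x}.
  by apply: filterS aeG => x Gx _; exact: f_lim.
have mEf : measurable_fun setT (EFin \o f) by exact/measurable_EFinP.
have [if_ lim_ _] := dominated_convergence measurableT mun mEf ff ig fg.
exists (L1_of if_) => e e0.
have : adist L1neg (u n) (L1_of if_) @[n --> \oo] --> (0 : R).
  apply: cvg_trans (fine_cvg lim_); apply: near_eq_cvg; apply: nearW => n /=.
  by rewrite -[RHS]/(fine (adist L1neg (u n) (L1_of if_))%:E) L1dist_EFin.
by move=> /cvgr0Pnorm_le/(_ _ e0)[N _ hN]; exists N => n Nn;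
  have := hN n Nn; rewrite ger0_norm ?adist_ge0.
Qed.

(** The value 0 at the sets that are not measurable makes this a family indexed by
    all sets, with the same span. *)
Definition L1_indic (G : set T) : L1 mu :=
  if pselect (measurable G) is left mG then L1_of (integrable_indic mu mG) else 0.

Lemma L1_indicE G x : measurable G -> L1_indic G x = \1_G x.
Proof. by rewrite /L1_indic; case: pselect. Qed.

(** Simple functions are dense in L1. *)
Lemma L1_indic_total : total_family L1neg L1_indic.
Proof.
move=> D cD Dind u; have [_ _ DZ clD] := cD; apply: clD => e e0.
have [g [ig _ lim_]] := approximation_sfun_integrable measurableT (L1_integrable u).
have lim0 : adist L1neg u (L1_of (ig n)) @[n --> \oo] --> (0 : R).
  apply: cvg_trans (fine_cvg lim_); apply: near_eq_cvg; apply: nearW => n /=.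
  by rewrite -[RHS]/(fine (adist L1neg u (L1_of (ig n)))%:E) L1dist_EFin.
have /cvgr0Pnorm_lt/(_ _ e0)[N _ /(_ N (leqnn _))] := lim0.
rewrite ger0_norm ?adist_ge0// => uN; exists (L1_of (ig N)) => //.
pose s := finmap.enum_fset (fset_set (range (g N))).
have -> : L1_of (ig N) = \sum_(r <- s) r *: L1_indic ((g N) @^-1` [set r]).
  apply/LfuneqP => x; rewrite L1_sumE [LHS](fimfunE (g N) x) fsbig_finite//=.
  apply: eq_bigr => r _.
  by rewrite -[RHS]/(r * L1_indic (g N @^-1` [set r]) x) L1_indicE.
by apply: (closed_subspace_sum _ cD) => r; exact: DZ.
Qed.

End L1_space.

(** * Bounded linear maps on an MV-algebra of functions *)

Local Open Scope mv_scope.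

Section L1u_functions.
Context d (T : measurableType d) (R : realType) (mu : probability T R).

Lemma L1u_integrable (f : L1u mu) : mu.-integrable setT (EFin \o (f : T -> R)).
Proof.
apply/integrableP; split; first by apply/measurable_EFinP; exact: L1u_measurable.
apply: (@le_lt_trans _ _ (\int[mu]_x (cst 1%E x))%E); last first.
  by rewrite integral_cst// mul1e (le_lt_trans (probability_le1 _ _))// ltry.
apply: ae_ge0_le_integral => //.
- by do 2 apply: measurableT_comp => //; exact: L1u_measurable.
- by apply: filterS (L1u_itv f) => x /andP[x0 x1] _ /=; rewrite lee_fin ger0_norm.
Qed.

Definition L1u_L1 (f : L1u mu) : L1 mu := L1_of (L1u_integrable f).

Lemma L1u_L1_itv f : {ae mu, forall x, 0 <= L1u_L1 f x <= 1}.
Proof. exact: L1u_itv. Qed.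

Lemma L1u_L1_ge0 f : {ae mu, forall x, 0 <= L1u_L1 f x}.
Proof. by apply: filterS (L1u_itv f) => x /andP[]. Qed.

Lemma L1u_L1_int f : L1int (L1u_L1 f) setT = L1u_int f.
Proof. by []. Qed.

Lemma L1u_L1_inj f g : adist (L1neg mu) (L1u_L1 f) (L1u_L1 g) = 0 -> f = g.
Proof. by move/L1dist_eq0 => fg; exact: L1u_eq. Qed.

Lemma L1u_L1_class (f : T -> R) mf f01 :
  {ae mu, forall x, L1u_L1 (@L1u_class _ T R mu f mf f01) x = f x}.
Proof. exact: L1u_classE. Qed.

Lemma L1u_L1_mvN f : {ae mu, forall x, L1u_L1 (¬ f) x = uneg (L1u_L1 f x)}.
Proof. exact: L1u_negE. Qed.

Lemma L1u_L1_mvD f g :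
  {ae mu, forall x, L1u_L1 (f ⊕ g) x = uadd (L1u_L1 f x) (L1u_L1 g x)}.
Proof. exact: L1u_addE. Qed.

Lemma L1u_L1_zero : {ae mu, forall x, L1u_L1 (mv_zero : L1u mu) x = 0}.
Proof. exact: L1u_zeroE. Qed.

Lemma L1u_L1_mvB f g :
  {ae mu, forall x, L1u_L1 (f ⊙ ¬ g) x = Num.max (L1u_L1 f x - L1u_L1 g x) 0}.
Proof.
apply: filterS3 (L1u_L1_mvN (¬ f ⊕ ¬ ¬ g)) (L1u_L1_mvD (¬ f) (¬ ¬ g))
  (L1u_L1_mvN f) => x h1 h2 h3; rewrite /mv_mul h1 h2 h3 mv_negK.
rewrite /uneg /uadd minEle maxEle; move: (L1u_L1 f x) (L1u_L1 g x) => a b.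
by case: (leP (1 - a + b) 1); case: (leP (a - b) 0); lra.
Qed.

Lemma L1u_leP (f g : L1u mu) :
  mv_le f g <-> {ae mu, forall x, L1u_L1 f x <= L1u_L1 g x}.
Proof.
split=> [fg|fg].
  have := L1u_L1_mvB f g; rewrite fg; apply: filterS2 L1u_L1_zero => x ->.
  by move=> h; rewrite -subr_le0 h le_max lexx.
apply: L1u_eq; apply: filterS3 fg (L1u_L1_mvB f g) L1u_L1_zero => x fg h1 h2.
by rewrite [LHS]h1 [RHS]h2 max_r// subr_le0.
Qed.

Lemma L1u_L1_partialD f g : mv_le f (¬ g) ->
  adist (L1neg mu) (L1u_L1 (f ⊕ g)) (L1u_L1 f + L1u_L1 g) = 0.
Proof.
move=> /L1u_leP fg; apply/L1dist_eq0.
apply: filterS3 fg (L1u_L1_mvD f g) (L1u_L1_mvN g) => x h -> hN.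
by rewrite L1DE uaddE//; move: h; rewrite hN /uneg; lra.
Qed.

End L1u_functions.

Section mv_reduction.
Variable A : mvType.
Implicit Types (a b : A) (s t : seq A).

Lemma mv_sub_le a b : mv_le (a ⊙ ¬ b) a.
Proof. by apply: mv_le_residual; rewrite mv_addC; exact: mv_le_addr. Qed.

Lemma mv_le_subN a b : mv_le a (¬ (b ⊙ ¬ a)).
Proof.
rewrite /mv_le mv_negK mv_mulC -mv_mulA (mv_mulC _ a) mv_mulxN.
by rewrite /mv_mul mv_addx1 mv_negK.
Qed.

(** Both sides are the infimum of [a] and [b]. *)
Lemma mv_meetC a b : a ⊙ ¬ (a ⊙ ¬ b) = b ⊙ ¬ (b ⊙ ¬ a).
Proof.
have E (x y : A) : x ⊙ ¬ (x ⊙ ¬ y) = ¬ ((x ⊙ ¬ y) ⊕ ¬ x).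
  by rewrite [LHS]/mv_mul mv_negK mv_addC.
have h := mv_joinC (¬ a) (¬ b); rewrite !mv_negK in h.
by rewrite (E a b) (E b a) (mv_mulC a) -h (mv_mulC b).
Qed.

(** The truncated difference of the sum of a list and [a], again as the sum of a
    list: each entry is cancelled as far as possible against what is left of
    [a]. *)
Fixpoint mv_reduce a t : seq A :=
  if t is b :: t' then (b ⊙ ¬ a) :: mv_reduce (a ⊙ ¬ b) t' else [::].

Variables (R : realType) (psi : A -> R).
Hypotheses (psi_ge0 : forall a, 0 <= psi a)
  (psiD : forall a b, mv_le a (¬ b) -> psi (a ⊕ b) = psi a + psi b).

(** The infimum of [a] and [b] cancels. *)
Lemma additive_sub a b : psi a - psi b = psi (a ⊙ ¬ b) - psi (b ⊙ ¬ a).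
Proof.
have split a' b' : psi a' = psi (a' ⊙ ¬ b') + psi (a' ⊙ ¬ (a' ⊙ ¬ b')).
  by rewrite -psiD -?(mv_le_decomp (mv_sub_le _ _)) //; exact: mv_le_subN.
by rewrite (split a b) (split b a) mv_meetC; lra.
Qed.

Lemma additive_reduce a t :
  \sum_(b <- t) psi b - psi a <= \sum_(b <- mv_reduce a t) psi b.
Proof.
elim: t a => [|b t IH] a /=; first by rewrite !big_nil sub0r oppr_le0.
have := IH (a ⊙ ¬ b); have := additive_sub a b; rewrite !big_cons; lra.
Qed.

Context d (T : measurableType d) (mu : probability T R).
Variable j : A -> L1u mu.
Hypothesis j_hom : mv_hom j.

Let J a : L1 mu := L1u_L1 (j a).

Let J_sub a b : {ae mu, forall x, J (a ⊙ ¬ b) x = Num.max (J a x - J b x) 0}.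
Proof.
have [_ jN jD] := j_hom.
have -> : J (a ⊙ ¬ b) = L1u_L1 (j a ⊙ ¬ j b).
  by rewrite /J /mv_mul jN jD !jN.
exact: L1u_L1_mvB.
Qed.

Let J_sum_ge0 s : {ae mu, forall x, 0 <= (\sum_(b <- s) J b) x}.
Proof.
elim: s => [|b s IH]; first by apply: aeW => x; rewrite big_nil.
by apply: filterS2 IH (L1u_L1_ge0 (j b)) => x h1 h2; rewrite big_cons L1DE addr_ge0.
Qed.

Lemma L1_reduce a t : {ae mu, forall x, (\sum_(b <- mv_reduce a t) J b) x =
  Num.max ((\sum_(b <- t) J b) x - J a x) 0}.
Proof.
elim: t a => [|b t IH] a; rewrite [mv_reduce _ _]/=.
  apply: filterS (L1u_L1_ge0 (j a)) => x ax.
  by rewrite !big_nil L10E sub0r max_r// oppr_le0.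
apply: filterS3 (filterI (IH (a ⊙ ¬ b)) (J_sum_ge0 t)) (J_sub a b) (J_sub b a).
move=> x [h1 t0] h2 h3; rewrite !big_cons !L1DE h1 h2 h3.
move: (J a x) (J b x) ((\sum_(b <- t) J b) x) t0 => u v w w0.
have [uv|uv] := leP u v.
  rewrite (max_l (_ : 0 <= v - u)) ?(max_r (_ : u - v <= 0)) ?subr_ge0 ?subr_le0//.
  by rewrite subr0 !max_l//; lra.
rewrite (max_r (_ : v - u <= 0)) ?(max_l (_ : 0 <= u - v)) ?subr_ge0 ?subr_le0 ?ltW//.
by rewrite add0r; congr Num.max; lra.
Qed.

(** By induction on [s], the list [t] being reduced by the first entry of [s]:
    in the end only [t] is left, where the bound on [psi] applies. *)
Lemma scalar_estimate (K : R) s t : 0 <= K ->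
  (forall a, psi a <= K * L1int (J a) setT) ->
  \sum_(b <- t) psi b - \sum_(b <- s) psi b <= K * L1neg mu (comb J s t).
Proof.
move=> K0 psiK; elim: s t => [|a s IH] t.
  rewrite /comb !big_nil sub0r subr0 L1negN// L1int_sum// mulr_sumr.
  exact: ler_sum.
rewrite big_cons opprD addrA.
apply: (@le_trans _ _ (\sum_(b <- mv_reduce a t) psi b - \sum_(b <- s) psi b)).
  by rewrite lerD2r additive_reduce.
apply: le_trans (IH _) _; apply: (ler_wpM2l K0); apply: L1neg_le_ae.
apply: filterS2 (L1_reduce a t) (J_sum_ge0 s) => x h1 h2.
rewrite /comb !L1BE h1 big_cons L1DE /negpart.
move: (J a x) ((\sum_(b <- s) J b) x) ((\sum_(b <- t) J b) x) h2 => u v w v0.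
rewrite !maxEle.
have [wu|wu] := leP (w - u) 0; have [?|?] := leP (- (u + v - w)) 0.
- by have [?|?] := leP (- (v - 0)) 0; lra.
- by have [?|?] := leP (- (v - 0)) 0; lra.
- by have [?|?] := leP (- (v - (w - u))) 0; lra.
- by have [?|?] := leP (- (v - (w - u))) 0; lra.
Qed.

End mv_reduction.

Section linear_extension.
Context d (T : measurableType d) d' (Z : measurableType d') (R : realType).
Variables (mu : probability T R) (zeta : probability Z R) (A : mvType).
Variables (j : A -> L1u mu) (phi : A -> L1u zeta) (K : R).
Hypotheses (j_hom : mv_hom j) (phi_linear : mv_linear phi) (K0 : 0 <= K).
Hypothesis phi_bound : forall a, L1u_int (phi a) <= K * L1u_int (j a).
Hypothesis j_total : total_family (L1neg mu) (fun a => L1u_L1 (j a)).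

(** Integrating the values of [phi] over a set gives a scalar additive functional,
    so that [scalar_estimate] bounds the seminorm of each combination. *)
Lemma linear_extension : exists2 w, posop (L1neg mu) (L1neg zeta) K w &
  forall a, adist (L1neg zeta) (w (L1u_L1 (j a))) (L1u_L1 (phi a)) = 0.
Proof.
apply: (posop_extension K0 _ (@L1_complete _ _ _ zeta) j_total) => s t.
have [G mG ->] := L1neg_attained (comb (fun a => L1u_L1 (phi a)) s t).
rewrite L1intB// opprB !L1int_sum//.
apply: (scalar_estimate (psi := fun a => L1int (L1u_L1 (phi a)) G)) => //.
- by move=> a; apply: L1int_ge0 => //; exact: L1u_L1_ge0.
- move=> a b ab; have [ab' ->] := phi_linear ab.
  by rewrite -L1intD//; apply: L1int_adist0 => //; exact: L1u_L1_partialD.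
- move=> a; apply: le_trans (phi_bound a).
  by rewrite -L1u_L1_int -L1negN ?L1int_le_neg//; exact: L1u_L1_ge0.
Qed.

End linear_extension.

(** The unit interval of an L1 space contains the indicators. *)
Lemma L1u_total d (T : measurableType d) (R : realType) (mu : probability T R) :
  total_family (L1neg mu) (@L1u_L1 _ T R mu).
Proof.
move=> D cD Du; apply: L1_indic_total => // G.
have [mG|nmG] := pselect (measurable G); last first.
  by rewrite /L1_indic; case: pselect => // _; case: cD.
have m1 : measurable_fun setT (\1_G : T -> R) by [].
have i1 : {ae mu, forall x, 0 <= (\1_G x : R) <= 1}.
  by apply: aeW => x; rewrite indicE ler0n lern1 leq_b1.
apply: (closed_subspace_eq cD _ (Du (L1u_class m1 i1))); apply/L1dist_eq0.
by apply: filterS (L1u_L1_class m1 i1) => x ->; rewrite L1_indicE.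
Qed.

(** * Density of an MV-algebra in its L1 model *)

Lemma mv_hom_le (A B : mvType) (f : A -> B) : mv_hom f ->
  forall a b, mv_le a b -> mv_le (f a) (f b).
Proof.
by move=> [f0 fN fD] a b ab; rewrite /mv_le /mv_mul -!(fN, fD) -f0 -ab.
Qed.

Lemma mv_hom_dist (A B : mvType) (f : A -> B) : mv_hom f ->
  forall a b, f (mv_dist a b) = mv_dist (f a) (f b).
Proof. by move=> [f0 fN fD] a b; rewrite /mv_dist /mv_mul !(fN, fD). Qed.

Lemma mv_hom_comp (A B C : mvType) (f : A -> B) (g : B -> C) :
  mv_hom f -> mv_hom g -> mv_hom (g \o f).
Proof.
move=> [f0 fN fD] [g0 gN gD]; split=> [|a|a b] /=.
- by rewrite f0.
- by rewrite fN.
- by rewrite fD.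
Qed.

Section completion_facts.
Variables (R : realType) (M : mvType) (s : state R M).

Lemma completion_in_hom : mv_hom (completion_in s).
Proof.
split=> // [a|a b]; apply/esym.
- by rewrite [LHS]completion_negE; exact: cauchy_class_eq.
- by rewrite [LHS]completion_addE; exact: cauchy_class_eq.
Qed.

Lemma state_rho a b : `|s a - s b| <= rho s a b.
Proof.
have half a' b' : s a' - s b' <= rho s a' b'.
  rewrite lerBlDl; apply: le_trans (state_le s (mv_le_join a' b')) _.
  apply: le_trans (state_add_le _ _ _) _; rewrite lerD2l.
  by apply: state_le; exact: mv_le_addr.
by rewrite ler_norml half lerNl opprB rhoC half.
Qed.

(** The state of a class can be computed on any representative. *)
Lemma completion_state_class (x : cauchy_seq s) :
  s (x n) @[n --> \oo] --> completion_state (cauchy_class x).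
Proof.
have cvg_repr : cvgn (fun n => s (repr (cauchy_class x) n)).
  apply/cauchy_cvgP/cauchy_exP => e e0.
  have [N hN] := Defs.cauchyP (repr (cauchy_class x)) e0.
  exists (s (repr (cauchy_class x) N)); exists N => // n /= Nn.
  by apply: le_lt_trans (state_rho _ _) (hN _ _ _ _).
have /cauchy_classP rx := esym (cauchy_class_repr (cauchy_class x)).
have d0 : s (x n) - s (repr (cauchy_class x) n) @[n --> \oo] --> (0 : R).
  apply/norm_cvg0P; apply: squeeze0 rx => n; rewrite normr_ge0/=.
  exact: state_rho.
have -> : (fun n => s (x n)) = (fun n => s (x n) - s (repr (cauchy_class x) n) +
    s (repr (cauchy_class x) n)) by apply/funext => n; rewrite subrK.
by rewrite -[completion_state _]add0r; exact: cvgD d0 cvg_repr.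
Qed.

Lemma completion_state_in a : completion_state (completion_in s a) = s a.
Proof.
apply: (@cvg_unique R (@Rhausdorff R) (nbhs ((fun=> s a) @ \oo))); last exact: cvg_cst.
exact: (@completion_state_class (cauchy_cst s a)).
Qed.

Lemma completion_dense (p : completion s) (e : R) : 0 < e ->
  exists a, completion_state (mv_dist p (completion_in s a)) <= e.
Proof.
move=> e0; have [N hN] := Defs.cauchyP (repr p) e0; exists (repr p N).
(* the distance to the constant sequence, term by term *)
pose y := cauchy_add
  (cauchy_neg (cauchy_add (cauchy_neg (repr p))
    (cauchy_neg (cauchy_neg (cauchy_cst s (repr p N))))))
  (cauchy_neg (cauchy_add (cauchy_neg (cauchy_cst s (repr p N)))
    (cauchy_neg (cauchy_neg (repr p))))).
have -> : mv_dist p (completion_in s (repr p N)) = cauchy_class y.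
  rewrite -{1}(cauchy_class_repr p) /mv_dist /mv_mul.
  by rewrite -!(completion_addE, completion_negE).
have cy := @completion_state_class y.
rewrite -(cvg_lim (@Rhausdorff R) cy); apply: limr_le; first exact: cvgP cy.
by exists N => // n /= Nn; apply: ltW; exact: hN.
Qed.

End completion_facts.

Lemma L1dist_mv_dist d (T : measurableType d) (R : realType)
    (mu : probability T R) (f g : L1u mu) :
  adist (L1neg mu) (L1u_L1 f) (L1u_L1 g) = L1u_int (mv_dist f g).
Proof.
have iabs : mu.-integrable setT (EFin \o (fun x => `|L1u_L1 f x - L1u_L1 g x|)).
  exact: integrable_abse (L1_integrable (L1u_L1 f - L1u_L1 g)).
rewrite L1distE -[LHS]/(L1int (L1_of iabs) setT) -L1u_L1_int.
apply: L1int_adist0 => //; apply/L1dist_eq0.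
apply: filterS3 (filterI (L1u_L1_mvB f g) (L1u_L1_mvB g f))
  (L1u_L1_mvD (f ⊙ ¬ g) (g ⊙ ¬ f)) (filterI (L1u_L1_itv f) (L1u_L1_itv g)).
move=> x [fg gf] D [/andP[f0 f1] /andP[g0 g1]]; rewrite [RHS]D fg gf L1_ofE.
move: (L1u_L1 f x) (L1u_L1 g x) f0 f1 g0 g1 => a b a0 a1 b0 b1.
have [ab|ab] := lerP a b.
  rewrite (max_r (_ : a - b <= 0)) ?(max_l (_ : 0 <= b - a)) ?subr_le0 ?subr_ge0//.
  by rewrite uaddE add0r//; lra.
rewrite (max_l (_ : 0 <= a - b)) ?(max_r (_ : b - a <= 0)) ?subr_le0 ?subr_ge0 ?ltW//.
by rewrite uaddE addr0//; lra.
Qed.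

Section model_density.
Variables (R : realType) (A : mvType) (E : CX_embedding R A) (sA : state R A).
Variable L : L1_model E sA.
Implicit Types (f g : divHull E) (t : seq A).

Let mu := model_mu L.

Definition model_in (a : A) : L1u mu := L (dcompl_in E sA a).

Lemma hull_in_hom : mv_hom (hull_in E).
Proof.
split=> [|a|a b]; apply: hull_eq => x /=.
- exact: emb0.
- exact: embN.
- exact: embD.
Qed.

Lemma model_in_hom : mv_hom model_in.
Proof.
apply: (@mv_hom_comp _ _ _ (dcompl_in E sA) L); last exact: model_hom.
exact: mv_hom_comp hull_in_hom (completion_in_hom _).
Qed.

Lemma model_in_int a : L1u_int (model_in a) = sA a.
Proof. by rewrite model_state [LHS]completion_state_in; exact: hull_state_in. Qed.

(** Lists shorter than the denominator are padded with zeros. *)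
Lemma hull_of_list (n : nat) t : (0 < n)%N -> (size t <= n)%N ->
  exists f, forall x, f x = \sum_(a <- t) E a x / n%:R.
Proof.
move=> n0 tn; have H : is_divisible_comb (fun x => \sum_(a <- t) E a x / n%:R).
  exists (t ++ nseq (n - size t) mv_zero).
    by rewrite size_cat size_nseq subnKC.
  move=> x; rewrite size_cat size_nseq subnKC// big_cat/= big_nseq.
  by rewrite emb0 mul0r iter_addr_0 mul0rn addr0.
by exists (DivHull H).
Qed.

Lemma hull_le f g : (forall x, f x + g x <= 1) -> mv_le f (¬ g).
Proof.
move=> fg; apply: hull_eq => x /=; rewrite /uneg.
have := fg x; have /andP[] := hull_itv f x; have /andP[] := hull_itv g x.
move: (f x) (g x) => u v *; rewrite minEle; case: leP; lra.
Qed.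

Let J f : L1 mu := L1u_L1 (L (completion_in (hull_state E sA) f)).

Lemma model_hullD (f g h : divHull E) : (forall x, f x = g x + h x) ->
  adist (L1neg mu) (J f) (J g + J h) = 0.
Proof.
move=> fgh; have gh x : g x + h x <= 1 by rewrite -fgh; case/andP: (hull_itv f x).
have -> : f = g ⊕ h by apply: hull_eq => x; rewrite fgh [RHS]uaddE.
rewrite /J.
have [_ _ cD] := completion_in_hom (hull_state E sA).
have [_ _ LD] := model_hom L.
have le_gh : mv_le (L (completion_in (hull_state E sA) g))
    (¬ L (completion_in (hull_state E sA) h)).
  have [_ cN _] := completion_in_hom (hull_state E sA); have [_ LN _] := model_hom L.
  rewrite -LN -cN; apply: (mv_hom_le (model_hom L)).
  by apply: (mv_hom_le (completion_in_hom _)); exact: hull_le.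
by rewrite cD LD; exact: L1u_L1_partialD.
Qed.

Lemma model_hull_scale n a f : (0 < n)%N -> (forall x, f x = E a x / n%:R) ->
  adist (L1neg mu) (J f) (n%:R^-1 *: L1u_L1 (model_in a)) = 0.
Proof.
move=> n0 fE; apply/L1dist_eq0.
have n01 : 0 <= (n%:R^-1 : R) <= 1.
  by rewrite invr_ge0 ler0n/= invf_le1 ?ltr0n// ler1n.
have ratrn : ratr (n%:R^-1 : rat) = n%:R^-1 :> R by rewrite fmorphV/= ratr_nat.
apply: (model_scale L n01).
exists (cauchy_cst _ (hull_in E a)), (cauchy_cst _ f), (fun=> n%:R^-1); split=> //.
- by move=> _; rewrite invr_ge0 ler0n/= invf_le1 ?ltr0n// ler1n.
- by rewrite ratrn; exact: cvg_cst.
- by move=> m x; rewrite ratrn [LHS]fE mulrC.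
Qed.

Lemma model_hull n t f : (0 < n)%N -> (size t <= n)%N ->
  (forall x, f x = \sum_(a <- t) E a x / n%:R) ->
  adist (L1neg mu) (J f) (n%:R^-1 *: \sum_(a <- t) L1u_L1 (model_in a)) = 0.
Proof.
move=> n0; elim: t f => [|a t IH] f tn fE.
  have -> : f = mv_zero by apply: hull_eq => x; rewrite fE big_nil.
  rewrite big_nil scaler0; apply/L1dist_eq0; rewrite /J.
  have [-> _ _] := completion_in_hom (hull_state E sA).
  by have [-> _ _] := model_hom L; exact: L1u_L1_zero.
have [g gE] : exists g : divHull E, forall x, g x = E a x / n%:R.
  have [g gE] := @hull_of_list n [:: a] n0 n0.
  by exists g => x; rewrite gE big_seq1.
have [h hE] := @hull_of_list n t n0 (ltnW tn).
have fgh x : f x = g x + h x by rewrite fE big_cons gE hE.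
apply: (adist0_trans (model_hullD fgh)).
rewrite big_cons scalerDr; apply: adist0D; first exact: model_hull_scale.
by apply: IH => //; exact: ltnW.
Qed.

(** The elements of the model are limits of averages of elements of [A], and the
    isomorphism takes averages to averages since it preserves scalars. *)
Lemma model_total : total_family (L1neg mu) (fun a => L1u_L1 (model_in a)).
Proof.
move=> D cD DA; have [_ _ DZ clD] := cD.
apply: L1u_total => // h.
have [invL _ LK] := model_bij L; rewrite -(LK h); move: (invL h) => p.
apply: clD => e e0; have e2 : 0 < e / 2 by rewrite divr_gt0.
have [f pf] := completion_dense p e2.
exists (J f).
  have [s s0 fE] := hullP f.
  apply: (closed_subspace_eq cD (model_hull s0 (leqnn _) fE)).
  by apply: DZ; exact: closed_subspace_sum cD _.
rewrite L1dist_mv_dist -(mv_hom_dist (model_hom L)) model_state.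
by apply: le_lt_trans pf _; lra.
Qed.

End model_density.

(** * Tensor products *)

Section tensor_products.
Context d1 d2 (X : measurableType d1) (Y : measurableType d2) (R : realType).
Variables (mu : probability X R) (nu : probability Y R).

Local Notation lam := (cld_prod mu nu : probability (cld_type mu nu) R).

(** On measurable sets of the product the completed measure is the product
    measure, so that Tonelli's theorem applies. *)
Lemma cld_integral_prod (f : X -> R) (g : Y -> R) :
  measurable_fun setT f -> measurable_fun setT g ->
  (forall x, 0 <= f x) -> (forall y, 0 <= g y) ->
  (\int[lam]_z (f z.1 * g z.2)%:E =
   \int[mu]_x (f x)%:E * \int[nu]_y (g y)%:E)%E.
Proof.
move=> mf mg f0 g0; pose h (z : X * Y) : \bar R := (f z.1 * g z.2)%:E.
have mh : measurable_fun setT h.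
  by apply/measurable_EFinP; apply: measurable_funM;
    exact: measurableT_comp.
have h0 z : (0 <= h z)%E by rewrite lee_fin mulr_ge0.
have mid : measurable_fun setT (id : cld_type mu nu -> X * Y).
  by move=> _ B mB; rewrite setTI; exact: cld_measurable.
transitivity (\int[(mu \x nu)%E]_z h z)%E.
  transitivity (\int[pushforward lam (id : cld_type mu nu -> X * Y)]_z h z)%E.
    by rewrite ge0_integral_pushforward.
  by apply: eq_measure_integral => A mA _; exact: cld_prodE.
rewrite fubini_tonelli1//.
under eq_integral => x _ do rewrite /fubini_F/=.
transitivity (\int[mu]_x ((f x)%:E * \int[nu]_y (g y)%:E))%E.
  apply: eq_integral => x _; rewrite -ge0_integralZl//; first exact/measurable_EFinP.
  - by move=> y _; rewrite lee_fin.
  - by rewrite lee_fin.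
rewrite ge0_integralZr//; first exact/measurable_EFinP.
- by move=> x _; rewrite lee_fin.
- by apply: integral_ge0 => y _; rewrite lee_fin.
Qed.

Lemma tens_integrable (f : L1 mu) (g : L1 nu) :
  lam.-integrable setT (EFin \o (fun z : cld_type mu nu => f z.1 * g z.2)).
Proof.
apply/integrableP; split.
  apply/measurable_EFinP; apply: cld_measurable_fun; apply: measurable_funM;
    exact: measurableT_comp.
under eq_integral => z _ do rewrite /= normrM.
rewrite (@cld_integral_prod (fun x => `|f x|) (fun y => `|g y|))//;
  [|exact: measurableT_comp..].
by apply: lte_mul_pinfty; [exact: integral_ge0| |];
  have /integrableP[_] := L1_integrable f; have /integrableP[_] := L1_integrable g;
  rewrite ?ge0_fin_numE ?integral_ge0.
Qed.

Definition tens f g : L1 lam := L1_of (tens_integrable f g).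

Lemma tensE f g z : tens f g z = f z.1 * g z.2. Proof. by []. Qed.

Lemma tensDl f f' g : tens (f + f') g = tens f g + tens f' g.
Proof. by apply/LfuneqP => z; rewrite !(tensE, L1DE) mulrDl. Qed.

Lemma tensZl c f g : tens (c *: f) g = c *: tens f g.
Proof. by apply/LfuneqP => z; rewrite !(tensE, L1ZE) mulrA. Qed.

Lemma tensDr f g g' : tens f (g + g') = tens f g + tens f g'.
Proof. by apply/LfuneqP => z; rewrite !(tensE, L1DE) mulrDr. Qed.

Lemma tensZr c f g : tens f (c *: g) = c *: tens f g.
Proof. by apply/LfuneqP => z; rewrite !(tensE, L1ZE) mulrCA. Qed.

(** Tonelli's theorem gives [tens_distl], [tens_distr], and the two factorizations
    of the seminorm below: for a nonnegative factor the negative part of a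
    product is the product with the negative part of the other factor. *)
Lemma tens_distl f f' g : adist (L1neg lam) (tens f g) (tens f' g) =
  adist (L1neg nu) g 0 * adist (L1neg mu) f f'.
Proof.
apply: EFin_inj; rewrite EFinM (L1dist0_EFin g) (L1dist_integral f f') muleC.
rewrite (L1dist_integral (tens f g) (tens f' g)).
rewrite -(@cld_integral_prod (fun x => `|f x - f' x|) (fun y => `|g y|))//.
- by apply: eq_integral => z _; rewrite -normrM mulrBl.
- by apply: measurableT_comp => //; apply: measurable_funB.
- exact: measurableT_comp.
Qed.

Lemma tens_distr f g g' : adist (L1neg lam) (tens f g) (tens f g') =
  adist (L1neg mu) f 0 * adist (L1neg nu) g g'.
Proof.
apply: EFin_inj; rewrite EFinM (L1dist0_EFin f) (L1dist_integral g g').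
rewrite (L1dist_integral (tens f g) (tens f g')).
rewrite -(@cld_integral_prod (fun x => `|f x|) (fun y => `|g y - g' y|))//.
- by apply: eq_integral => z _; rewrite -normrM mulrBr.
- exact: measurableT_comp.
- by apply: measurableT_comp => //; apply: measurable_funB.
Qed.

Lemma L1neg_factor (u : L1 lam) (a : X -> R) (b : Y -> R) :
  measurable_fun setT a -> measurable_fun setT b ->
  (forall x, 0 <= a x) -> (forall y, 0 <= b y) ->
  {ae lam, forall z, negpart (u z) = a z.1 * b z.2} ->
  (L1neg lam u)%:E = (\int[mu]_x (a x)%:E * \int[nu]_y (b y)%:E)%E.
Proof.
move=> ma mb a0 b0 uab; rewrite L1neg_EFin -cld_integral_prod//.
apply: ae_eq_integral.
- exact: measurableT.
- by have /measurable_int := integrable_negpart u.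
- apply/measurable_EFinP; apply: cld_measurable_fun; apply: measurable_funM;
    exact: measurableT_comp.
- by apply: filterS uab => z -> _.
Qed.

Lemma L1neg_tensl (f : L1 mu) (g : L1 nu) : {ae nu, forall y, 0 <= g y} ->
  L1neg lam (tens f g) = L1neg mu f * L1int g setT.
Proof.
move=> g0; apply: EFin_inj; rewrite EFinM -L1negN// !L1neg_EFin -L1neg_EFin.
rewrite (@L1neg_factor _ (negpart \o f) (negpart \o (- g)))//.
- exact: measurable_negpart.
- exact: measurable_negpart.
- by move=> x; exact: negpart_ge0.
- by move=> x; exact: negpart_ge0.
have := cld_ae (aeW mu (fun x : X => I)) g0; apply: filterS => z [_ gz].
rewrite tensE -[RHS]/(negpart (f z.1) * negpart (- g z.2)) /negpart opprK (max_l gz).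
by rewrite -mulNr -{1}(mul0r (g z.2)) maxr_pMl.
Qed.

Lemma L1neg_tensr (f : L1 mu) (g : L1 nu) : {ae mu, forall x, 0 <= f x} ->
  L1neg lam (tens f g) = L1int f setT * L1neg nu g.
Proof.
move=> f0; apply: EFin_inj; rewrite EFinM -L1negN// !L1neg_EFin -L1neg_EFin.
rewrite (@L1neg_factor _ (negpart \o (- f)) (negpart \o g))//.
- exact: measurable_negpart.
- exact: measurable_negpart.
- by move=> x; exact: negpart_ge0.
- by move=> x; exact: negpart_ge0.
have := cld_ae f0 (aeW nu (fun x : Y => I)); apply: filterS => z [fz _].
rewrite tensE -[RHS]/(negpart (- f z.1) * negpart (g z.2)) /negpart opprK (max_l fz).
by rewrite -mulrN -{1}(mulr0 (f z.1)) maxr_pMr.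
Qed.

Lemma tens_closed_l (D : L1 lam -> Prop) (g : L1 nu) :
  closed_subspace (L1neg lam) D ->
  closed_subspace (L1neg mu) (fun f => D (tens f g)).
Proof.
apply: (closed_subspace_preim (f := tens^~ g) (adist_ge0 (L1neg nu) g 0)).
- by move=> x y; exact: tensDl.
- by move=> a x; exact: tensZl.
- by move=> x y; rewrite tens_distl.
Qed.

Lemma tens_closed_r (D : L1 lam -> Prop) (f : L1 mu) :
  closed_subspace (L1neg lam) D ->
  closed_subspace (L1neg nu) (fun g => D (tens f g)).
Proof.
apply: (closed_subspace_preim (f := tens f) (adist_ge0 (L1neg mu) f 0)).
- by move=> x y; exact: tensDr.
- by move=> a x; exact: tensZr.
- by move=> x y; rewrite tens_distr.
Qed.

Lemma L1int_indic (G : set (cld_type mu nu)) : measurable G ->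
  (L1int (L1_indic lam G) setT)%:E = lam G.
Proof.
move=> mG; transitivity (\int[lam]_z (\1_G z)%:E)%E; last first.
  by rewrite integral_indic// setIT.
rewrite fineK; last by apply: integrable_fin_num => //; exact: L1_integrable.
by apply: eq_integral => z _; rewrite L1_indicE.
Qed.

Lemma L1dist_ge (u v : L1 lam) : {ae lam, forall z, v z <= u z} ->
  adist (L1neg lam) u v = L1int u setT - L1int v setT.
Proof.
move=> vu; have uv0 : {ae lam, forall z, 0 <= (u - v) z}.
  by apply: filterS vu => z; rewrite L1BE subr_ge0.
by rewrite /adist (L1neg_eq0 _).2// add0r -opprB L1negN// L1intB.
Qed.

Lemma L1_indic_subset (G H : set (cld_type mu nu)) : measurable G ->
  measurable H -> G `<=` H ->
  {ae lam, forall z, L1_indic lam G z <= L1_indic lam H z}.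
Proof.
move=> mG mH GH; apply: aeW => z; rewrite !L1_indicE// !indicE ler_nat.
by case: (boolP (z \in G)) => //; rewrite inE => /GH Hz; rewrite mem_set.
Qed.

Section rectangles.
Variable D : L1 lam -> Prop.
Hypotheses (clD : closed_subspace (L1neg lam) D)
  (Dtens : forall f g, D (tens f g)).

(** Dynkin's lemma: indicators of rectangles are tensor products. *)
Let indic_prod (S : set (X * Y)) : measurable S ->
  D (L1_indic lam (S : set (cld_type mu nu))).
Proof.
have [_ DD _ limD] := clD.
have rect (A : set X) (B : set Y) : measurable A -> measurable B ->
    D (L1_indic lam (A `*` B : set (cld_type mu nu))).
  move=> mA mB; have -> : L1_indic lam (A `*` B : set (cld_type mu nu)) =
      tens (L1_indic mu A) (L1_indic nu B); last exact: Dtens.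
  apply/LfuneqP => -[x y]; rewrite tensE !L1_indicE//; last first.
    by apply: cld_measurable; exact: measurableX.
  by rewrite !indicE in_setX/= -natrM mulnb.
have DT : D (L1_indic lam setT).
  by rewrite -setXTT; exact: rect.
move: S; rewrite measurable_prod_measurableType.
apply: dynkin_induction => //.
- by rewrite measurable_prod_measurableType.
- move=> U V [U1 mU1 [U2 mU2 <-{U}]] [V1 mV1 [V2 mV2 <-{V}]].
  exists (U1 `&` V1); first exact: measurableI.
  by exists (U2 `&` V2); [exact: measurableI|rewrite setXI].
- by move=> _ [A mA [B mB <-]]; exact: rect.
- move=> S mS DS.
  have mS' := @cld_measurable _ _ _ _ _ mu nu _ mS.
  have -> : L1_indic lam (~` S : set (cld_type mu nu)) =
      L1_indic lam setT - L1_indic lam (S : set (cld_type mu nu)).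
    apply/LfuneqP => z; rewrite L1BE !L1_indicE//; last exact: measurableC.
    rewrite !indicE in_setT in_setC.
    by case: (_ \in _); rewrite ?subrr ?subr0.
  exact: closed_subspaceB clD DT DS.
- move=> F mF tF DF.
  have mF' n := @cld_measurable _ _ _ _ _ mu nu _ (mF n).
  apply: limD => e e0.
  have mU : measurable (\bigcup_n F n : set (cld_type mu nu)).
    exact: (bigcupT_measurable _ mF').
  pose v n := \sum_(0 <= i < n) L1_indic lam (F i : set (cld_type mu nu)).
  have vU n : {ae lam, forall z, v n z <= L1_indic lam (\bigcup_n F n) z}.
    apply: aeW => z; rewrite /v L1_sumE L1_indicE//.
    under eq_bigr => i _ do rewrite (L1_indicE lam z (mF' i)) indicE.
    elim: n => [|n IH]; first by rewrite big_nil indicE ler0n.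
    rewrite big_nat_recr//=.
    case: (boolP (z \in F n)) => [/set_mem zFn|_]; last by rewrite addr0.
    rewrite indicE mem_set; last by exists n.
    rewrite big_nat big1 ?add0r// => i /andP[_ ni].
    rewrite memNset// => zFi.
    have := tF i n I I; rewrite -/(F i) => /(_ (ex_intro _ z (conj zFi zFn))) E.
    by rewrite E ltnn in ni.
  have : adist (L1neg lam) (L1_indic lam (\bigcup_n F n)) (v n) @[n --> \oo] --> (0 : R).
    have -> : (fun n => adist (L1neg lam) (L1_indic lam (\bigcup_n F n)) (v n)) =
        (fun n => L1int (L1_indic lam (\bigcup_n F n)) setT -
           \sum_(0 <= i < n) L1int (L1_indic lam (F i)) setT).
      by apply/funext => n; rewrite L1dist_ge// /v L1int_sum.
    rewrite -[X in _ --> X](subrr (L1int (L1_indic lam (\bigcup_n F n)) setT)).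
    apply: cvgB; first exact: cvg_cst.
    have cv : (fun n => (\sum_(0 <= i < n) L1int (L1_indic lam (F i)) setT)%:E) @ \oo
        --> (L1int (L1_indic lam (\bigcup_n F n)) setT)%:E.
      rewrite (L1int_indic mU).
      have -> : (fun n => (\sum_(0 <= i < n) L1int (L1_indic lam (F i)) setT)%:E) =
          (fun n => \sum_(0 <= i < n) lam (F i))%E.
        apply/funext => n; rewrite -sumEFin.
        by apply: eq_bigr => i _; rewrite (L1int_indic (mF' i)).
      exact: (@measure_semi_sigma_additive _ _ _ lam _ mF' tF mU).
    exact: fine_cvg cv.
  move=> /cvgr0Pnorm_lt/(_ _ e0)[N _ /(_ N (leqnn _))].
  rewrite ger0_norm ?adist_ge0// => UN; exists (v N) => //.
  exact: closed_subspace_sum clD _.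
Qed.

(** By definition of the outer measure, a measurable set of the completion is
    contained in measurable sets of the product that are arbitrarily little
    larger. *)
Let indic_cld (S : set (cld_type mu nu)) : measurable S -> D (L1_indic lam S).
Proof.
have [_ _ _ limD] := clD; move=> mS; apply: limD => e e0.
have fS : lam S \is a fin_num by exact: fin_num_measure.
have [_ [F [mF SF] <-]] := @lb_ereal_inf_adherent R _ _ e0 fS.
rewrite -[ereal_inf _]/(lam S) => FS.
have mF' n := @cld_measurable _ _ _ _ _ mu nu _ (mF n).
have mU : measurable (\bigcup_n F n) by exact: bigcupT_measurable.
have mU' := @cld_measurable _ _ _ _ _ mu nu _ mU.
exists (L1_indic lam (\bigcup_n F n)); first exact: indic_prod.
rewrite adistC L1dist_ge; last exact: L1_indic_subset.
rewrite ltrBlDr -lte_fin EFinD (L1int_indic mU') (L1int_indic mS) addeC.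
apply: le_lt_trans FS; rewrite [leLHS]cld_prodE//.
exact: measure_sigma_subadditive.
Qed.

Lemma tens_closed_total u : D u.
Proof.
apply: L1_indic_total => // G; have [mG|nmG] := pselect (measurable G).
  exact: indic_cld.
by rewrite /L1_indic; case: pselect => // _; case: clD.
Qed.

End rectangles.

Lemma tens_total (I J : Type) (u : I -> L1 mu) (v : J -> L1 nu) :
  total_family (L1neg mu) u -> total_family (L1neg nu) v ->
  total_family (L1neg lam) (fun k : I * J => tens (u k.1) (v k.2)).
Proof.
move=> tu tv D clD Duv; apply: tens_closed_total => // f.
apply: tv; first exact: tens_closed_r.
move=> j; move: f; apply: tu; first exact: tens_closed_l.
by move=> i; exact: (Duv (i, j)).
Qed.

End tensor_products.

(** * Extension of bounded bilinear maps *)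

Lemma L1neg_disjoint d (T : measurableType d) (R : realType)
    (mu : probability T R) (u v : L1 mu) : (forall x, u x = 0 \/ v x = 0) ->
  L1neg mu (u + v) = L1neg mu u + L1neg mu v.
Proof.
move=> uv; rewrite !L1negE -RintegralD//; [|exact: integrable_negpart..].
apply: eq_Rintegral => x _; rewrite L1DE.
have n0 : negpart 0 = 0 :> R by rewrite /negpart oppr0 maxxx.
by have [->|->] := uv x; rewrite n0 ?(add0r, addr0).
Qed.

Lemma addr_regroup (V : zmodType) (a b c d e : V) :
  a + b + (c + (d + e)) = a + c + d + (b + e).
Proof. by rewrite addrACA -[RHS]addrA [X in _ = _ + X]addrCA. Qed.

Section bilinear_extension.
Context d1 d2 d3 (X : measurableType d1) (Y : measurableType d2)
  (Z : measurableType d3) (R : realType).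
Variables (mu : probability X R) (nu : probability Y R) (zeta : probability Z R).
Variables (A B : mvType) (jA : A -> L1u mu) (jB : B -> L1u nu).
Variables (gamma : A -> B -> L1u zeta) (K : R).

Hypotheses (jA_hom : mv_hom jA) (jB_hom : mv_hom jB).
Hypothesis jA_total : total_family (L1neg mu) (fun a => L1u_L1 (jA a)).
Hypothesis jB_total : total_family (L1neg nu) (fun b => L1u_L1 (jB b)).
Hypotheses (gamma_bilinear : mv_bilinear gamma) (K0 : 0 <= K).
Hypothesis gamma_bound : forall a b,
  L1u_int (gamma a b) <= K * (L1u_int (jA a) * L1u_int (jB b)).

Local Notation lam := (cld_prod mu nu : probability (cld_type mu nu) R).

Let JA a : L1 mu := L1u_L1 (jA a).
Let JB b : L1 nu := L1u_L1 (jB b).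
Let KB b : R := K * L1int (JB b) setT.

Let KB_ge0 b : 0 <= KB b.
Proof. by rewrite mulr_ge0//; apply: L1int_ge0 => //; exact: L1u_L1_ge0. Qed.

(** For fixed [b] the map [gamma^~ b] is bounded by [K] times the integral of
    [b]. *)
Lemma bilinear_extension_left : exists w : B -> L1 mu -> L1 zeta, forall b,
  posop (L1neg mu) (L1neg zeta) (KB b) (w b) /\
  forall a, adist (L1neg zeta) (w b (JA a)) (L1u_L1 (gamma a b)) = 0.
Proof.
suff /choice[w hw] : forall b, exists w : L1 mu -> L1 zeta,
    posop (L1neg mu) (L1neg zeta) (KB b) w /\
    forall a, adist (L1neg zeta) (w (JA a)) (L1u_L1 (gamma a b)) = 0.
  by exists w.
move=> b; have [|w hw wE] := linear_extension (phi := gamma^~ b) jA_hom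
  (gamma_bilinear.1 b) (KB_ge0 b) _ jA_total; last by exists w.
by move=> a; rewrite -mulrA (mulrC (L1int _ _)); exact: gamma_bound.
Qed.

Section second_variable.
Variable w : B -> L1 mu -> L1 zeta.
Hypothesis w_posop : forall b, posop (L1neg mu) (L1neg zeta) (KB b) (w b).
Hypothesis wE : forall a b,
  adist (L1neg zeta) (w b (JA a)) (L1u_L1 (gamma a b)) = 0.

(** Both sides are operators in [f], and they agree at the elements of [A]. *)
Let w_add b b' f : mv_le b (¬ b') ->
  adist (L1neg zeta) (w (b ⊕ b') f) (w b f + w b' f) = 0.
Proof.
move=> bb'; have cl := posop_equalizer (KB_ge0 (b ⊕ b'))
  (addr_ge0 (KB_ge0 b) (KB_ge0 b')) (w_posop (b ⊕ b'))
  (posop_add (w_posop b) (w_posop b')).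
apply: (jA_total cl) => a; apply: (adist0_trans (wE a _)).
have [le_gamma ->] := gamma_bilinear.2 a b b' bb'.
apply: (adist0_trans (L1u_L1_partialD le_gamma)).
by apply: adist0D; rewrite adistC; exact: wE.
Qed.

Section estimate.
Variables (G : set Z) (mG : measurable G).

Let g (E : set X) b : R := L1int (w b (L1_indic mu E)) G.

Let indic_ge0 E : {ae mu, forall x, 0 <= L1_indic mu E x}.
Proof.
apply: aeW => x; rewrite /L1_indic; case: pselect => // mE.
Qed.

Let g_ge0 E b : 0 <= g E b.
Proof.
apply: L1int_ge0 => //; apply/L1neg_eq0; apply/le_anti.
rewrite asym_ge0 andbT; apply: le_trans (posop_bound (w_posop b) _) _.
by rewrite (L1neg_eq0 _).2 ?mulr0.
Qed.

Let g_add E b b' : mv_le b (¬ b') -> g E (b ⊕ b') = g E b + g E b'.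
Proof.
by move=> bb'; rewrite -L1intD//; apply: L1int_adist0 => //; exact: w_add.
Qed.

Let g_le E b : g E b <= (K * L1int (L1_indic mu E) setT) * L1int (JB b) setT.
Proof.
apply: le_trans (L1int_le_neg _ mG) _.
rewrite -(asym_adist0 (posopN (w_posop b) (L1_indic mu E))).
apply: le_trans (posop_bound (w_posop b) _) _.
by rewrite L1negN// mulrAC.
Qed.

Let indic_split D E : measurable D -> measurable E ->
  L1_indic mu D = L1_indic mu (D `&` E) + L1_indic mu (D `\` E).
Proof.
move=> mD mE; apply/LfuneqP => x.
rewrite L1DE !L1_indicE ?indicE; [|exact: measurableD|exact: measurableI|by []].
rewrite in_setI in_setD.
by case: (x \in D); case: (x \in E); rewrite ?(addr0, add0r).
Qed.

Let g_split D E b : measurable D -> measurable E ->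
  g D b = g (D `&` E) b + g (D `\` E) b.
Proof.
move=> mD mE; rewrite -L1intD//; apply: L1int_adist0 => //.
by rewrite (indic_split mD mE); exact: (posopD (w_posop b)).
Qed.

Let h E (m : seq B * seq B) : R :=
  \sum_(b <- m.1) g E b - \sum_(b <- m.2) g E b.
Let F (m : seq B * seq B) : L1 nu := comb JB m.1 m.2.
Let U E m : L1 lam := tens (L1_indic mu E) (F m).
Let cat2 (m m' : seq B * seq B) := (m.1 ++ m'.1, m.2 ++ m'.2).

Let h_cat E m m' : h E (cat2 m m') = h E m + h E m'.
Proof. by rewrite /h/= !big_cat/= opprD addrACA. Qed.

Let U_cat E m m' : U E (cat2 m m') = U E m + U E m'.
Proof. by rewrite /U /F comb_cat tensDr. Qed.

Let h_split D E m : measurable D -> measurable E ->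
  h D m = h (D `&` E) m + h (D `\` E) m.
Proof.
move=> mD mE; rewrite /h; under eq_bigr do rewrite (g_split _ mD mE).
under [X in _ - X]eq_bigr do rewrite (g_split _ mD mE).
by rewrite !big_split/= opprD addrACA.
Qed.

Let U_split D E m : measurable D -> measurable E ->
  U D m = U (D `&` E) m + U (D `\` E) m.
Proof. by move=> mD mE; rewrite /U (indic_split mD mE) tensDl. Qed.

(** For a fixed set [E] only the variable of [B] is left. *)
Let h_base E m : - h E m <= K * L1neg lam (U E m).
Proof.
rewrite opprB L1neg_tensr// mulrA.
apply: (scalar_estimate (g_ge0 E) (@g_add E) jB_hom).
  by rewrite mulr_ge0// L1int_ge0.
by move=> b; exact: g_le.
Qed.

Let U_out E m z : measurable E -> z.1 \notin E -> U E m z = 0.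
Proof.
by move=> mE zE; rewrite /U tensE L1_indicE// indicE (negbTE zE) mul0r.
Qed.

(** Splitting along the sets one after the other makes the functions of [x]
    constant on the pieces, where the estimate in the other variable applies;
    the seminorm is additive over disjoint pieces. *)
Let h_estimate (l : seq ({E : set X | measurable E} * (seq B * seq B))) D m :
  measurable D ->
  - (h D m + \sum_(k <- l) h (D `&` sval k.1) k.2) <=
  K * L1neg lam (U D m + \sum_(k <- l) U (D `&` sval k.1) k.2).
Proof.
elim: l D m => [|[[E mE] m'] l IH] D m mD.
  by rewrite !big_nil !addr0; exact: h_base.
rewrite !big_cons ![(_, m').1]/= ![(_, m').2]/= ![sval (exist _ E mE)]/=.
have mDE : measurable (D `&` E) by exact: measurableI.
have mDnE : measurable (D `\` E) by exact: measurableD.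
have IH1 := IH _ (cat2 m m') mDE; have IH2 := IH _ m mDnE.
set U1 := (X in _ <= K * L1neg lam X) in IH1.
set U2 := (X in _ <= K * L1neg lam X) in IH2.
have hE : h D m + (h (D `&` E) m' + \sum_(k <- l) h (D `&` sval k.1) k.2) =
    (h (D `&` E) (cat2 m m') + \sum_(k <- l) h (D `&` E `&` sval k.1) k.2) +
    (h (D `\` E) m + \sum_(k <- l) h ((D `\` E) `&` sval k.1) k.2).
  rewrite (h_split m mD mE) h_cat.
  have -> : \sum_(k <- l) h (D `&` sval k.1) k.2 =
      \sum_(k <- l) h (D `&` E `&` sval k.1) k.2 +
      \sum_(k <- l) h ((D `\` E) `&` sval k.1) k.2.
    rewrite -big_split/=; apply: eq_bigr => -[[E' mE'] m''] _ /=.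
    by rewrite (h_split _ (measurableI _ _ mD mE') mE) !setDE (setIAC D E' E)
      (setIAC D E').
  exact: addr_regroup.
have UE : U D m + (U (D `&` E) m' + \sum_(k <- l) U (D `&` sval k.1) k.2) = U1 + U2.
  rewrite /U1 /U2 (U_split m mD mE) U_cat.
  have -> : \sum_(k <- l) U (D `&` sval k.1) k.2 =
      \sum_(k <- l) U (D `&` E `&` sval k.1) k.2 +
      \sum_(k <- l) U ((D `\` E) `&` sval k.1) k.2.
    rewrite -big_split/=; apply: eq_bigr => -[[E' mE'] m''] _ /=.
    by rewrite (U_split _ (measurableI _ _ mD mE') mE) !setDE (setIAC D E' E)
      (setIAC D E').
  exact: addr_regroup.
(* [U1] lives over [D `&` E] and [U2] over [D `\` E] *)
rewrite hE UE L1neg_disjoint; last first.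
  move=> z; have [zDE|zDE] := boolP (z.1 \in D `&` E).
    right; rewrite /U2 L1DE L1_sumE U_out//; last first.
      by move: zDE; rewrite in_setD in_setI => /andP[-> ->].
    rewrite big1 ?addr0// => k _.
    rewrite U_out//; first exact: measurableI mDnE (svalP k.1).
    by rewrite in_setI in_setD; move: zDE; rewrite in_setI => /andP[-> ->].
  left; rewrite /U1 L1DE L1_sumE U_out//.
  rewrite big1 ?addr0// => k _.
  rewrite U_out//; first exact: measurableI mDE (svalP k.1).
  by rewrite in_setI (negbTE zDE).
rewrite mulrDr opprD; exact: lerD IH1 IH2.
Qed.

Lemma rectangle_estimate (s t : seq ({E : set X | measurable E} * B)) :
  \sum_(k <- t) g (sval k.1) k.2 - \sum_(k <- s) g (sval k.1) k.2 <=
  K * L1neg lam (comb (fun k => tens (L1_indic mu (sval k.1)) (JB k.2)) s t).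
Proof.
pose l := [seq (k.1, ([:: k.2], [::])) | k <- s] ++
          [seq (k.1, ([::], [:: k.2])) | k <- t].
have hl : h setT ([::], [::]) + \sum_(k <- l) h (setT `&` sval k.1) k.2 =
    \sum_(k <- s) g (sval k.1) k.2 - \sum_(k <- t) g (sval k.1) k.2.
  rewrite /l big_cat !big_map {1}/h !big_nil subrr add0r -sumrN.
  by congr (_ + _); apply: eq_bigr => k _;
    rewrite setTI /h big_seq1 big_nil ?subr0 ?sub0r.
have Ul : U setT ([::], [::]) + \sum_(k <- l) U (setT `&` sval k.1) k.2 =
    comb (fun k => tens (L1_indic mu (sval k.1)) (JB k.2)) s t.
  rewrite /l big_cat !big_map {1}/U {1}/F /comb !big_nil subrr.
  rewrite -{1}(scale0r (0 : L1 nu)) tensZr scale0r add0r -sumrN.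
  congr (_ + _); apply: eq_bigr => k _; rewrite setTI /U /F /comb big_seq1 big_nil.
    by rewrite subr0.
  by rewrite sub0r -scaleN1r tensZr scaleN1r.
by have := h_estimate l ([::], [::]) measurableT; rewrite hl Ul opprB.
Qed.

End estimate.

(** The indicators times elements of [B] are total in the product, and for fixed
    [b] the operator agrees with [w b] at the indicators, hence everywhere. *)
Lemma bilinear_extension_right : exists2 W, posop (L1neg lam) (L1neg zeta) K W &
  forall a b, adist (L1neg zeta) (W (tens (JA a) (JB b))) (L1u_L1 (gamma a b)) = 0.
Proof.
have total : total_family (L1neg lam)
    (fun k : {E : set X | measurable E} * B =>
      tens (L1_indic mu (sval k.1)) (JB k.2)).
  apply: (tens_total
    (u := fun E : {E : set X | measurable E} => L1_indic mu (sval E))) => //.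
  move=> D clD DE; apply: L1_indic_total => // E.
  have [mE|nmE] := pselect (measurable E); first exact: (DE (exist _ E mE)).
  by rewrite /L1_indic; case: pselect => // _; case: clD.
have est s t : L1neg zeta (comb (fun k => w k.2 (L1_indic mu (sval k.1))) s t) <=
    K * L1neg lam (comb (fun k : {E : set X | measurable E} * B =>
      tens (L1_indic mu (sval k.1)) (JB k.2)) s t).
  have [G mG ->] :=
    L1neg_attained (comb (fun k => w k.2 (L1_indic mu (sval k.1))) s t).
  by rewrite L1intB// opprB !L1int_sum//; exact: rectangle_estimate.
have [W hW WE] := posop_extension K0 est (@L1_complete _ _ _ zeta) total.
exists W => // a b.
have hWb : posop (L1neg mu) (L1neg zeta) (KB b) (fun f => W (tens f (JB b))).
  split=> [x y|c x|x].
  - by rewrite tensDl; exact: (posopD hW).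
  - by rewrite tensZl; exact: (posopZ hW).
  - apply: le_trans (posop_bound hW _) _.
    by rewrite (L1neg_tensl x (L1u_L1_ge0 (jB b))) mulrA mulrAC.
have cl := posop_equalizer (KB_ge0 b) (KB_ge0 b) hWb (w_posop b).
apply: adist0_trans (wE a b); apply: (L1_indic_total cl) => E.
have [mE|nmE] := pselect (measurable E); first exact: (WE (exist _ E mE, b)).
by rewrite /L1_indic; case: pselect => // _; case: cl.
Qed.

End second_variable.

Lemma bilinear_extension : exists2 W, posop (L1neg lam) (L1neg zeta) K W &
  forall a b, adist (L1neg zeta) (W (tens (JA a) (JB b))) (L1u_L1 (gamma a b)) = 0.
Proof.
have [w hw] := bilinear_extension_left.
exact: (bilinear_extension_right (fun b => (hw b).1) (fun a b => (hw b).2 a)).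
Qed.

End bilinear_extension.

(** * Universal property of the product space *)

Lemma mv_linear_hom (A B C : mvType) (w : A -> B) (f : B -> C) :
  mv_linear w -> mv_hom f -> mv_linear (f \o w).
Proof.
move=> lw hf a b /lw[wab wD]; have [_ fN fD] := hf.
by split=> /=; [rewrite -fN; exact: mv_hom_le|rewrite wD fD].
Qed.

Lemma mv_hom_can (A B : mvType) (f : A -> B) (g : B -> A) :
  cancel f g -> cancel g f -> mv_hom f -> mv_hom g.
Proof.
move=> fK gK [f0 fN fD]; split=> [|a|a b].
- by rewrite -f0 fK.
- by rewrite -[in LHS](gK a) -fN fK.
- by rewrite -[in LHS](gK a) -[in LHS](gK b) -fD fK.
Qed.

Section unit_interval_operators.
Context d (T : measurableType d) d' (Z : measurableType d') (R : realType).
Variables (mu : probability T R) (zeta : probability Z R).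

Lemma L1u_of_L1 (u : L1 zeta) : {ae zeta, forall z, 0 <= u z <= 1} ->
  exists f : L1u zeta, adist (L1neg zeta) (L1u_L1 f) u = 0.
Proof.
move=> u01; exists (L1u_class (L1_measurable u) u01); apply/L1dist_eq0.
exact: L1u_L1_class.
Qed.

Variables (K : R) (W : L1 mu -> L1 zeta).
Hypothesis hW : posop (L1neg mu) (L1neg zeta) K W.

Lemma posop_ge0 (u : L1 mu) : {ae mu, forall x, 0 <= u x} ->
  {ae zeta, forall z, 0 <= W u z}.
Proof.
move=> /L1neg_eq0 u0; apply/L1neg_eq0/le_anti; rewrite asym_ge0 andbT.
by have := posop_bound hW u; rewrite u0 mulr0.
Qed.

(** Once 1 goes to an element of the unit interval, so does [f <= 1], because the
    image of [1 - f] is nonnegative. *)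
Lemma posop_unit_interval (one : L1u mu) (g : L1u zeta) :
  {ae mu, forall x, L1u_L1 one x = 1} ->
  adist (L1neg zeta) (W (L1u_L1 one)) (L1u_L1 g) = 0 ->
  exists w : L1u mu -> L1u zeta, forall f,
    adist (L1neg zeta) (L1u_L1 (w f)) (W (L1u_L1 f)) = 0.
Proof.
move=> one1 /L1dist_eq0 W1.
suff /choice[w hw] : forall f, exists f' : L1u zeta,
    adist (L1neg zeta) (L1u_L1 f') (W (L1u_L1 f)) = 0 by exists w.
move=> f; apply: L1u_of_L1.
have one_f : {ae mu, forall x, 0 <= (L1u_L1 one - L1u_L1 f) x}.
  apply: filterS2 one1 (L1u_L1_itv f) => x x1 /andP[_].
  by rewrite L1BE x1 subr_ge0.
have /L1dist_eq0 WB := posopB hW (L1u_L1 one) (L1u_L1 f).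
apply: filterS3 (filterI (posop_ge0 (L1u_L1_ge0 f)) (posop_ge0 one_f))
  (filterI WB W1) (L1u_L1_itv g).
move=> z [Wf0 Wonef0] [WBz W1z] /andP[_ g1]; rewrite Wf0/= -subr_ge0.
apply: le_trans (_ : L1u_L1 g z - W (L1u_L1 f) z <= _); last by rewrite lerB.
by rewrite -W1z -L1BE -WBz.
Qed.

Lemma posop_int_le (u : L1 mu) (f : L1u zeta) :
  adist (L1neg zeta) (L1u_L1 f) (W u) = 0 -> {ae mu, forall x, 0 <= u x} ->
  L1u_int f <= K * L1int u setT.
Proof.
move=> fW u0; rewrite -L1u_L1_int -(L1negN u0) -L1negN; last exact: L1u_L1_ge0.
have e : adist (L1neg zeta) (- L1u_L1 f) (W (- u)) = 0.
  apply: (@adist0_trans _ _ _ (- W u)); first by rewrite adistN.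
  by rewrite adistC; exact: (posopN hW).
by rewrite (asym_adist0 e); exact: (posop_bound hW).
Qed.

(** An additive map into the unit interval of an L1 space takes summable pairs
    to summable pairs, because the value at the sum is at most 1. *)
Lemma mv_linear_posop (w : L1u mu -> L1u zeta) :
  (forall f, adist (L1neg zeta) (L1u_L1 (w f)) (W (L1u_L1 f)) = 0) ->
  mv_linear w.
Proof.
move=> wW f g fg.
have /L1dist_eq0 sum : adist (L1neg zeta) (L1u_L1 (w (f ⊕ g)))
    (L1u_L1 (w f) + L1u_L1 (w g)) = 0.
  apply: (adist0_trans (wW _)).
  apply: (adist0_trans (posop_adist0 hW (L1u_L1_partialD fg))).
  apply: (adist0_trans (posopD hW _ _)); apply: adist0D; rewrite adistC; exact: wW.
split.
  apply/L1u_leP; apply: filterS3 sum (L1u_L1_mvN (w g)) (L1u_L1_itv (w (f ⊕ g))).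
  by move=> z + -> /andP[_ +]; rewrite L1DE /uneg => -> ; lra.
apply: L1u_L1_inj; apply/L1dist_eq0.
apply: filterS3 sum (L1u_L1_mvD (w f) (w g)) (L1u_L1_itv (w (f ⊕ g))).
by move=> z + -> /andP[_ +]; rewrite L1DE => -> h; rewrite uaddE.
Qed.

End unit_interval_operators.

(** Both maps extend to L1, and the extensions agree on a total family. *)
Lemma bounded_linear_unique d (T : measurableType d) d' (Z : measurableType d')
    (R : realType) (mu : probability T R) (zeta : probability Z R)
    (I : Type) (u : I -> L1u mu) (v v' : L1u mu -> L1u zeta) (K K' : R) :
  0 <= K -> 0 <= K' -> total_family (L1neg mu) (fun i => L1u_L1 (u i)) ->
  mv_linear v -> mv_linear v' ->
  (forall f, L1u_int (v f) <= K * L1u_int f) ->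
  (forall f, L1u_int (v' f) <= K' * L1u_int f) ->
  (forall i, v (u i) = v' (u i)) -> forall f, v f = v' f.
Proof.
move=> K0 K'0 tu lv lv' bv bv' vv' f.
have hom_id : mv_hom (@id (L1u mu)) by [].
have [V hV VE] := linear_extension hom_id lv K0 bv (@L1u_total _ _ _ mu).
have [V' hV' VE'] := linear_extension hom_id lv' K'0 bv' (@L1u_total _ _ _ mu).
have VV' x : adist (L1neg zeta) (V x) (V' x) = 0.
  apply: (tu _ (posop_equalizer K0 K'0 hV hV')) => i.
  by apply: (adist0_trans (VE _)); rewrite vv' adistC; exact: VE'.
apply: L1u_L1_inj; have := VE f; rewrite adistC => /adist0_trans; apply.
exact: adist0_trans (VV' _) (VE' f).
Qed.

Lemma mv_hom_L1u_one d (T : measurableType d) (R : realType)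
    (mu : probability T R) (A : mvType) (j : A -> L1u mu) : mv_hom j ->
  {ae mu, forall x, L1u_L1 (j mv_one) x = 1}.
Proof.
move=> [j0 jN _]; rewrite /mv_one jN j0.
apply: filterS2 (L1u_L1_mvN (mv_zero : L1u mu)) (@L1u_L1_zero _ _ _ mu).
by move=> x -> ->; rewrite /uneg subr0.
Qed.

Section tensor_universal.
Context d1 d2 d3 (X : measurableType d1) (Y : measurableType d2)
  (Z : measurableType d3) (R : realType).
Variables (mu : probability X R) (nu : probability Y R) (zeta : probability Z R).
Variables (A B : mvType) (jA : A -> L1u mu) (jB : B -> L1u nu).
Hypotheses (jA_hom : mv_hom jA) (jB_hom : mv_hom jB).
Hypothesis jA_total : total_family (L1neg mu) (fun a => L1u_L1 (jA a)).
Hypothesis jB_total : total_family (L1neg nu) (fun b => L1u_L1 (jB b)).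

Local Notation lam := (cld_prod mu nu : probability (cld_type mu nu) R).

Let tensor_tens a b : adist (L1neg lam) (L1u_L1 (tensor (jA a) (jB b)))
  (tens (L1u_L1 (jA a)) (L1u_L1 (jB b))) = 0.
Proof. by apply/L1dist_eq0; exact: L1u_L1_class. Qed.

Lemma tensor_total : total_family (L1neg lam)
  (fun k : A * B => L1u_L1 (tensor (jA k.1) (jB k.2))).
Proof.
move=> D clD Dtensor; apply: (tens_total jA_total jB_total clD) => k.
by apply: (closed_subspace_eq clD _ (Dtensor k)); rewrite adistC; exact: tensor_tens.
Qed.

Variables (gamma : A -> B -> L1u zeta) (K : R).
Hypotheses (gamma_bilinear : mv_bilinear gamma) (K0 : 0 <= K).
Hypothesis gamma_bound : forall a b,
  L1u_int (gamma a b) <= K * (L1u_int (jA a) * L1u_int (jB b)).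

(** The operator preserves the unit interval since it maps the constant 1 to
    [gamma mv_one mv_one]. *)
Lemma tensor_universal : exists v : L1u lam -> L1u zeta,
  [/\ mv_linear v, forall h, L1u_int (v h) <= K * L1u_int h &
    forall a b, v (tensor (jA a) (jB b)) = gamma a b].
Proof.
have [W hW WE] := bilinear_extension jA_hom jB_hom jA_total jB_total
  gamma_bilinear K0 gamma_bound.
have Wtensor a b : adist (L1neg zeta) (W (L1u_L1 (tensor (jA a) (jB b))))
    (L1u_L1 (gamma a b)) = 0.
  by apply: adist0_trans (WE a b); apply: (posop_adist0 hW); exact: tensor_tens.
have one1 : {ae lam, forall z, L1u_L1 (tensor (jA mv_one) (jB mv_one)) z = 1}.
  have /L1dist_eq0 := tensor_tens mv_one mv_one.
  apply: filterS2 (cld_ae (mv_hom_L1u_one jA_hom) (mv_hom_L1u_one jB_hom)).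
  by move=> z [a1 b1] ->; rewrite tensE a1 b1 mulr1.
have [v hv] := posop_unit_interval hW one1 (Wtensor mv_one mv_one).
exists v; split.
- exact: (mv_linear_posop hW hv).
- by move=> h; exact: (posop_int_le hW (hv h) (L1u_L1_ge0 h)).
- by move=> a b; apply: L1u_L1_inj; exact: adist0_trans (hv _) (Wtensor a b).
Qed.

End tensor_universal.

Lemma L1u_int_le1 (R : realType) (A : mvType) (E : CX_embedding R A)
    (s : state R A) (L : L1_model E s) (f : L1u (model_mu L)) : L1u_int f <= 1.
Proof.
have <- : L1u_int (model_in L mv_one) = 1.
  by rewrite model_in_int; have [_ _] := stateP s.
rewrite -!L1u_L1_int -subr_ge0 -L1intB//; apply: L1int_ge0 => //.
apply: filterS2 (mv_hom_L1u_one (model_in_hom L)) (L1u_L1_itv f).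
by move=> z h /andP[_ f1]; rewrite L1BE h subr_ge0.
Qed.

Theorem theorem3p1 (R : realType) (A B C : mvType)
    (sA : state R A) (sB : state R B) (sC : state R C)
    (probA : probability_mv sA) (probB : probability_mv sB)
    (probC : probability_mv sC)
    (EA : CX_embedding R A) (EB : CX_embedding R B) (EC : CX_embedding R C)
    (LA : L1_model EA sA) (LB : L1_model EB sB) (LC : L1_model EC sC)
    (gamma : A -> B -> C) :
  mv_bilinear gamma -> mv_bounded2 sA sB sC gamma ->
  exists! omega : product_space LA LB -> dcompl EC sC,
    [/\ mv_linear omega,
        mv_bounded (@product_state R A B EA EB sA sB LA LB)
          (@dcompl_state R C EC sC) omega &
        forall a b, omega (product_beta LA LB a b) = dcompl_in EC sC (gamma a b)].
Proof.
move=> gamma_bilinear [K K1 gamma_bound]; have K0 : 0 <= K%:R :> R by [].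
have [invLC KLC LCK] := model_bij LC.
pose G a b := model_in LC (gamma a b).
have lG : mv_bilinear G.
  split=> [b|a]; have := model_in_hom LC.
    exact: mv_linear_hom (gamma_bilinear.1 b).
  exact: mv_linear_hom (gamma_bilinear.2 a).
have bG a b : L1u_int (G a b) <=
    K%:R * (L1u_int (model_in LA a) * L1u_int (model_in LB b)).
  by rewrite /G !model_in_int; have := gamma_bound a b; rewrite le_min => /andP[].
have [v [lv bv vE]] := tensor_universal (model_in_hom LA) (model_in_hom LB)
  (@model_total _ _ _ _ LA) (@model_total _ _ _ _ LB) lG K0 bG.
exists (invLC \o v); split.
  split.
  - exact: (mv_linear_hom lv (mv_hom_can KLC LCK (model_hom LC))).
  - exists K => // h; rewrite /= -(model_state LC) LCK le_min L1u_int_le1 andbT.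
    exact: bv.
  - by move=> a b /=; rewrite -[RHS]KLC; congr invLC; exact: vE.
move=> w [lw [K' _ bw] wE]; apply/funext => h; rewrite -[RHS]KLC /=; congr invLC.
have bw' f : L1u_int (LC (w f)) <= K'%:R * L1u_int f.
  by rewrite model_state; have := bw f; rewrite le_min => /andP[].
apply: (bounded_linear_unique K0 (ler0n R K') _ lv
  (mv_linear_hom lw (model_hom LC)) bv bw').
  exact: (tensor_total (@model_total _ _ _ _ LA) (@model_total _ _ _ _ LB)).
by move=> [a b] /=; rewrite [RHS](congr1 LC (wE a b)); exact: vE.
Qed.
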